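(* Let $\mathbbm{k}$ be a field of characteristic $0$ and let $N \geqslant 3$. Then the defining ideal $I \subseteq \mathbbm{k}[x_0,\dots,x_N]$ of a general set of $s$ points in $\mathbb{P}^N_{\mathbbm{k}}$ (for any $s \geqslant 1$) has expected resurgence, i.e. $\rho(I) < N$.
   Context: For a homogeneous ideal $I$ in $R=\mathbbm{k}[x_0,\dots,x_N]$ and $m \in \mathbb{N}$, the $m$-th symbolic power is $I^{(m)} = \bigcap_{\mathfrak{p} \in \operatorname{Ass}(I)} (I^m R_{\mathfrak{p}} \cap R)$; for the ideal of a finite set of points with point ideals $\mathfrak{p}_1,\dots,\mathfrak{p}_s$, $I^{(m)} = \mathfrak{p}_1^m \cap \dots \cap \mathfrak{p}_s^m$. The resurgence of $I$ is $\rho(I) = \sup\{a/b : I^{(a)} \not\subseteq I^b\}$. The big height of $I$ is the maximal height of a minimal prime of $I$ (it equals $N$ for the ideal of a finite set of points in $\mathbb{P}^N$); $I$ is said to have expected resurgence if $\rho(I)$ is strictly less than its big height. A property holds for a general set of $s$ points in $\mathbb{P}^N_{\mathbbm{k}}$ if there is a nonempty Zariski open (dense) subset $U$ of the parameter space of $s$ points (e.g. of $\mathbb{A}^{s(N+1)}_{\mathbbm{k}}$, where $\mathbf{a}=(a_{ij})$ gives the points $[a_{i0}:\dots:a_{iN}]$, $1\le i\le s$, which are distinct for $\mathbf a$ in $U$) such that the property holds for every set of points corresponding to a point of $U$. *)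

(* Defs.v *)
From HB Require Import structures.
From mathcomp Require Import all_boot all_order all_algebra.
From mathcomp Require Import mpoly.
Set Implicit Arguments. Unset Strict Implicit. Unset Printing Implicit Defensive.
Import Order.TTheory GRing.Theory Num.Theory.
Local Open Scope ring_scope.

Definition ideal_gen (P : comNzRingType) (S : P -> Prop) : P -> Prop :=
  fun f => exists (n : nat) (c g : 'I_n -> P),
      (forall i, S (g i)) /\ f = \sum_(i < n) c i * g i.

Definition ideal_pow (P : comNzRingType) (I : P -> Prop) (m : nat) : P -> Prop :=
  ideal_gen (fun f => exists g : 'I_m -> P,
                 (forall i, I (g i)) /\ f = \prod_(i < m) g i).

Definition ideal_sub (P : comNzRingType) (I J : P -> Prop) : Prop :=
  forall f, I f -> J f.

Definition point_ideal (k : fieldType) (N : nat) (a : 'I_N.+1 -> k)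
  : {mpoly k[N.+1]} -> Prop :=
  ideal_gen (fun F => exists d : nat, F \is d.-homog /\ F.@[a] = 0).

Definition points_ideal (k : fieldType) (N s : nat) (a : 'I_s -> 'I_N.+1 -> k)
  : {mpoly k[N.+1]} -> Prop :=
  ideal_gen (fun F => exists d : nat,
                 F \is d.-homog /\ forall i, F.@[a i] = 0).

Definition points_symb_pow (k : fieldType) (N s : nat) (a : 'I_s -> 'I_N.+1 -> k)
  (m : nat) : {mpoly k[N.+1]} -> Prop :=
  fun f => forall i, ideal_pow (point_ideal (a i)) m f.

(* rho(I) < x, where rho(I) = sup { a/b : a, b >= 1, I^(a) not<= I^b }:
   the supremum is < x iff some c < x bounds every such ratio. *)
Definition resurgence_lt (P : comNzRingType) (I : P -> Prop)
  (symb : nat -> P -> Prop) (x : rat) : Prop :=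
  exists c : rat, c < x /\
    forall a b : nat, (0 < a)%N -> (0 < b)%N ->
      ~ ideal_sub (symb a) (ideal_pow I b) -> a%:R / b%:R <= c.

Definition zariski_open (k : fieldType) (n : nat) (U : ('I_n -> k) -> Prop) : Prop :=
  exists J : {mpoly k[n]} -> Prop,
    forall v, U v <-> ~ (forall p, J p -> p.@[v] = 0).

(* Parameter space A^{s(N+1)}: a point is a matrix A : 'M_(s, N.+1), the
   i-th point being [A i 0 : ... : A i N]; coordinates via mxvec. *)
Definition param_coords (k : fieldType) (s N : nat) (A : 'M[k]_(s, N.+1))
  : 'I_(s * N.+1) -> k := fun j => mxvec A 0 j.

Definition distinct_proj_points (k : fieldType) (s N : nat) (A : 'M[k]_(s, N.+1))
  : Prop :=
  (forall i, exists j, A i j != 0) /\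
  (forall i i', i != i' -> ~ exists t : k, forall j, A i j = t * A i' j).

Definition general_points (k : fieldType) (s N : nat)
  (Q : ('I_s -> 'I_N.+1 -> k) -> Prop) : Prop :=
  exists U : ('I_(s * N.+1) -> k) -> Prop,
    zariski_open U /\ (exists v, U v) /\
    forall A : 'M[k]_(s, N.+1), U (param_coords A) ->
      distinct_proj_points A /\ Q (fun i j => A i j).

(* Main.v *)
(** Let [r] be minimal such that forms of degree [r - 1] separate [s] general points.
    Separators [F_i] of degree [r - 1] show that a form of degree at least [b r] lying in
    the [b]-th symbolic power lies in [I^b].  Hence [rho(I) < N] as soon as forms of
    degree [D] with multiplicity [M] at all the points satisfy [D / M >= c] for some
    [c > r / N].

    Such a [c] must be uniform in [M] on one open set.  If no form of degree less than [d]
    has multiplicity [m] at the points, then [M d <= D (m + N)] for every form of degree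
    [D] and multiplicity [M].  To see this, specialize the coordinates to an algebraically
    closed field of characteristic [p] without losing the hypothesis; there, taking q-th
    roots of coefficients (a Cartier operator) turns a form of degree [q D] and
    multiplicity [(m + N) q] into one of degree at most [D] and multiplicity [m].  The
    hypothesis is open in the points, and it holds, with [N d > r (m + N)], for a grid of
    [(floor(r / N) + 1)^N <= s] points, or, in the one case [N = r = 3] where [s] may be
    too small, for the vertices of a simplex. *)

Require Import Defs.
From HB Require Import structures.
From mathcomp Require Import all_boot all_order all_algebra all_field.
From mathcomp Require Import mpoly zify ring.
From Stdlib Require Import Classical FunctionalExtensionality.
Set Implicit Arguments. Unset Strict Implicit. Unset Printing Implicit Defensive.
Import Order.TTheory GRing.Theory Num.Theory.
Local Open Scope ring_scope.

(** * Ideals and filtrations *)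

Section Ideals.

Variable P : comNzRingType.
Implicit Types (S I : P -> Prop) (J : nat -> P -> Prop) (f g x y : P).

(** For each [M] the condition on forms of multiplicity [M] is open in the points, but over a
    countable field infinitely many nonempty open sets may have no common point. The degree bound
    replaces them all by one pair [(m, d)]: it gives [D / M >= d / (m + N)], so the special
    configurations only have to provide [r (m + N) < N d] once. The loss [N] is a pigeonhole effect:
    among [(m + N) q] factors taken from N + 1 linear forms, at least [m] disjoint q-th powers can
    be extracted. Only linear algebra crosses the change of characteristic. The hypothesis on
    [(m, d)] is a nonzero minor, the existence of a form is the vanishing of all maximal minors, and
    no form is itself reduced. For the containment, a form of degree at least [b r] is rewritten
    modulo [I^b] as a combination of the powers [F_i^b]; multiplicities at the points then control
    the coefficients. *)

Lemma ideal_gen_ind S (Q : P -> Prop) :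
    Q 0 -> (forall x y, Q x -> Q y -> Q (x + y)) ->
    (forall c x, S x -> Q (c * x)) ->
  forall f, ideal_gen S f -> Q f.
Proof. by move=> Q0 QD QM f [n [c [g [Sg ->]]]]; elim/big_ind: _ => // i _; exact: QM. Qed.

Lemma ideal_gen0 S : ideal_gen S 0.
Proof. by exists 0, (fun _ => 0), (fun _ => 0); split=> [[]|]//; rewrite big_ord0. Qed.

Lemma ideal_genD S f g : ideal_gen S f -> ideal_gen S g -> ideal_gen S (f + g).
Proof.
case=> m [c [x [Sx ->]]] [n [d [y [Sy ->]]]].
exists (m + n)%N, (fun i => match split i with inl j => c j | inr j => d j end),
  (fun i => match split i with inl j => x j | inr j => y j end).
split=> [i|]; first by case: (split i).
rewrite big_split_ord /=; congr (_ + _); apply: eq_bigr => i _.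
  by case: splitP => j /= ij; [have -> : i = j by apply: val_inj | case: i ij => i /= + ij; rewrite ij; lia].
case: splitP => j /= ij; first by case: j ij => j /= + ij; rewrite -ij; lia.
by have -> : i = j by apply: val_inj => /=; lia.
Qed.

Lemma ideal_genM S c f : ideal_gen S f -> ideal_gen S (c * f).
Proof.
case=> m [d [x [Sx ->]]]; exists m, (fun i => c * d i), x; split=> //.
by rewrite big_distrr /=; apply: eq_bigr => i _; rewrite mulrA.
Qed.

Lemma ideal_gen_mem S x : S x -> ideal_gen S x.
Proof. by move=> Sx; exists 1%N, (fun _ => 1), (fun _ => x); split=> //; rewrite big_ord1 mul1r. Qed.

Lemma ideal_gen_sum S (T : Type) (r : seq T) (Q : pred T) (F : T -> P) :
  (forall i, Q i -> ideal_gen S (F i)) -> ideal_gen S (\sum_(i <- r | Q i) F i).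
Proof. by move=> SF; elim/big_ind: _ => //; [exact: ideal_gen0 | exact: ideal_genD]. Qed.

Lemma ideal_powM I i j f g :
  ideal_pow I i f -> ideal_pow I j g -> ideal_pow I (i + j) (f * g).
Proof.
move=> If; elim/ideal_gen_ind: g / => [|x y|c y [u [Iu ->]]].
- by rewrite mulr0; exact: ideal_gen0.
- by rewrite mulrDr; exact: ideal_genD.
rewrite mulrCA; apply: ideal_genM; elim/ideal_gen_ind: f / If => [|x z|d x [v [Iv ->]]].
- by rewrite mul0r; exact: ideal_gen0.
- by rewrite mulrDl; exact: ideal_genD.
rewrite -mulrA; apply: ideal_genM; apply: ideal_gen_mem.
exists (fun k => match split k with inl l => v l | inr l => u l end).
split=> [k|]; first by case: (split k).
rewrite big_split_ord /=; congr (_ * _); apply: eq_bigr => k _.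
  by case: splitP => l /= kl; [have -> : k = l by apply: val_inj | case: k kl => k /= + kl; rewrite kl; lia].
case: splitP => l /= kl; first by case: l kl => l /= + kl; rewrite -kl; lia.
by have -> : k = l by apply: val_inj => /=; lia.
Qed.

Lemma ideal_pow0 I f : ideal_pow I 0 f.
Proof.
rewrite -[f]mulr1; apply: ideal_genM; apply: ideal_gen_mem.
by exists (fun _ => 0); split=> [[]|]//; rewrite big_ord0.
Qed.

Lemma ideal_pow1 I f : I f -> ideal_pow I 1 f.
Proof. by move=> If; apply: ideal_gen_mem; exists (fun _ => f); rewrite big_ord1. Qed.

Lemma ideal_powS I (I' : P -> Prop) m f :
  (forall x, I x -> I' x) -> ideal_pow I m f -> ideal_pow I' m f.
Proof.
move=> IJ; elim/ideal_gen_ind: f / => [|x y|c y [u [Iu ->]]].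
- exact: ideal_gen0.
- exact: ideal_genD.
by apply: ideal_genM; apply: ideal_gen_mem; exists u; split=> // i; exact: IJ.
Qed.

Lemma ideal_pow_recl I m (Q : P -> Prop) :
    Q 0 -> (forall x y, Q x -> Q y -> Q (x + y)) ->
    (forall x y, I x -> ideal_pow I m y -> Q (x * y)) ->
  forall f, ideal_pow I m.+1 f -> Q f.
Proof.
move=> Q0 QD QM; apply: ideal_gen_ind => // c _ [u [Iu ->]].
rewrite big_ord_recl mulrCA; apply: QM => //; apply: ideal_genM.
by apply: ideal_gen_mem; exists (fun i => u (lift ord0 i)).
Qed.

Lemma ideal_pow_pred I m f : ideal_pow I m.+1 f -> ideal_pow I m f.
Proof.
move: f; apply: ideal_pow_recl; first exact: ideal_gen0.
  exact: ideal_genD.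
by move=> x y _; exact: ideal_genM.
Qed.

(** Powers of an ideal, multiplicity at a point and order at a vertex of a simplex are all of this
    kind, and comparing two of them only requires a look at generators. As [J 0] is everything, the
    product clause makes each [J i] an ideal. *)
Definition filtration J : Prop :=
  [/\ forall x, J 0%N x, forall i, J i 0,
      forall i x y, J i x -> J i y -> J i (x + y),
      forall i j x y, J i x -> J j y -> J (i + j)%N (x * y)
    & forall i x, J i.+1 x -> J i x].

Lemma filtration_le J i j x : filtration J -> (i <= j)%N -> J j x -> J i x.
Proof.
by case=> _ _ _ _ Jp; elim: j => [|j IH]; [rewrite leqn0 => /eqP -> | rewrite leq_eqVlt => /orP[/eqP -> //|] /IH{}IH /Jp].
Qed.

Lemma filtrationX J i x m : filtration J -> J i x -> J (i * m)%N (x ^+ m).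
Proof.
case=> J0 _ _ JM _ Jx; elim: m => [|m IH]; first by rewrite muln0.
by rewrite mulnS exprS; exact: JM.
Qed.

Lemma filtration_sum J i (T : Type) (r : seq T) (Q : pred T) (F : T -> P) :
  filtration J -> (forall t, Q t -> J i (F t)) -> J i (\sum_(t <- r | Q t) F t).
Proof. by case=> _ J0 JD _ _ JF; elim/big_ind: _ => // x y; exact: JD. Qed.

Lemma ideal_pow_filtration I : filtration (ideal_pow I).
Proof.
split; [exact: ideal_pow0 | by move=> i; exact: ideal_gen0
       | by move=> i; exact: ideal_genD | exact: ideal_powM | exact: ideal_pow_pred].
Qed.

Lemma ideal_powX I m x : I x -> ideal_pow I m (x ^+ m).
Proof.
by move=> Ix; rewrite -{1}[m]mul1n; apply: filtrationX; [exact: ideal_pow_filtration | exact: ideal_pow1].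
Qed.

Lemma ideal_pow_sub_filtration I J m f :
  filtration J -> (forall x, I x -> J 1%N x) -> ideal_pow I m f -> J m f.
Proof.
move=> FJ IJ; case: (FJ) => J0 J00 JD JM _.
elim: m f => [|m IH] f; first by move=> _; exact: J0.
apply: ideal_pow_recl f => // [x y|x y Ix /IH Jy]; first exact: JD.
by rewrite -add1n; apply: JM => //; exact: IJ.
Qed.

Lemma filtration_coefM J (p q : {poly P}) : filtration J ->
    (forall i, J i p`_i) -> (forall i, J i q`_i) ->
  forall i, J i (p * q)`_i.
Proof.
move=> FJ Jp Jq i; rewrite coefM; apply: filtration_sum => // -[j ltji] _ /=.
by case: FJ => _ _ _ JM _; rewrite -{1}(subnKC (ltji : (j <= i)%N)); exact: JM.
Qed.

Lemma filtration_coefXn J (p : {poly P}) m : filtration J ->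
  (forall i, J i p`_i) -> forall i, J i (p ^+ m)`_i.
Proof.
move=> FJ Jp; elim: m => [|m IH] i; last by rewrite exprS; exact: filtration_coefM.
by case: (FJ) => J0 J00 _ _ _; rewrite expr0 coef1; case: i.
Qed.

End Ideals.

Lemma coef_mul_eq0 (P : idomainType) (p q : {poly P}) m : p`_0 != 0 ->
  (forall i, (i < m)%N -> (p * q)`_i = 0) -> forall i, (i < m)%N -> q`_i = 0.
Proof.
move=> p0 pq0 i; elim/ltn_ind: i => i IH lt_im.
have := pq0 i lt_im; rewrite coefM big_ord_recl subn0 big1 ?addr0 => [/eqP|j _].
  by rewrite mulf_eq0 (negbTE p0) => /eqP.
by rewrite IH ?mulr0 //= /bump; case: j => j /=; lia.
Qed.

(** * Multiplicity at a point *)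

Lemma coef_linear (P : nzRingType) (c d : P) i :
  (c%:P + 'X * d%:P)`_i = if i == 0%N then c else if i == 1%N then d else 0.
Proof. by case: i => [|[|i]]; rewrite coefD coefXM !coefC /= ?addr0 ?add0r. Qed.

(** When [a ord0 != 0] these forms generate the ideal of the point [a]. The one with [j = ord0] is
    zero. *)
HB.lock Definition lin (A : nzRingType) (N : nat) (a : 'I_N.+1 -> A) (j : 'I_N.+1) :
  {mpoly A[N.+1]} := a ord0 *: 'X_j - a j *: 'X_ord0.

HB.lock Definition tay_var (A : nzRingType) (N : nat) (a : 'I_N.+1 -> A) (j : 'I_N.+1) :
  {poly {mpoly A[N.+1]}} := (a j *: 'X_ord0)%:P + 'X * (lin a j)%:P.

(* [tay a f] is [f] along the line from [x_0 a] (at 'X = 0) to [a_0 x]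
   (at 'X = 1); its order of vanishing at 'X = 0 is the multiplicity at [a]. *)
HB.lock Definition tay (A : comNzRingType) (N : nat) (a : 'I_N.+1 -> A)
  (f : {mpoly A[N.+1]}) : {poly {mpoly A[N.+1]}} :=
  mmap (polyC \o @mpolyC N.+1 A) (tay_var a) f.

Section Taylor.

Variables (A : comNzRingType) (N : nat).
Implicit Types (a : 'I_N.+1 -> A) (f g : {mpoly A[N.+1]}).

Lemma linE a j : lin a j = a ord0 *: 'X_j - a j *: 'X_ord0.
Proof. by rewrite lin.unlock. Qed.

Lemma tayE a : tay a =1 mmap (polyC \o @mpolyC N.+1 A) (tay_var a).
Proof. by move=> f; rewrite tay.unlock. Qed.

Lemma tay_is_additive a : additive (tay a).
Proof. by move=> f g; rewrite !tayE; exact: raddfB. Qed.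

Lemma tay_is_multiplicative a : multiplicative (tay a).
Proof. by split=> [f g|]; rewrite !tayE; [exact: rmorphM | exact: rmorph1]. Qed.

HB.instance Definition _ a := GRing.isAdditive.Build _ _ (tay a) (tay_is_additive a).
HB.instance Definition _ a :=
  GRing.isMultiplicative.Build _ _ (tay a) (tay_is_multiplicative a).

Definition mult a (m : nat) f : Prop := forall i, (i < m)%N -> (tay a f)`_i = 0.

Lemma tayX a mu : tay a 'X_[mu] = \prod_(j < N.+1) tay_var a j ^+ mu j.
Proof. by rewrite tayE; exact: mmapX. Qed.

Lemma tayZ a c f : tay a (c *: f) = (c%:MP)%:P * tay a f.
Proof. by rewrite !tayE; exact: mmapZ. Qed.

Lemma tayXU a j : tay a 'X_j = tay_var a j.
Proof. by rewrite tayE mmapX mmap1U. Qed.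

Lemma tay_var1 a j : (tay_var a j).[1] = a ord0 *: 'X_j.
Proof. by rewrite tay_var.unlock hornerD hornerM hornerX !hornerC mul1r linE addrC subrK. Qed.

Lemma tay_varE a j i : (tay_var a j)`_i =
  if i == 0%N then a j *: 'X_ord0 else if i == 1%N then lin a j else 0.
Proof. by rewrite tay_var.unlock; exact: coef_linear. Qed.

Lemma coef0_tay_var a j : (tay_var a j)`_0 = a j *: 'X_ord0.
Proof. by rewrite tay_varE. Qed.

Lemma mult_filtration a : filtration (mult a).
Proof.
split.
- by move=> x i.
- by move=> i j _; rewrite rmorph0 coef0.
- by move=> i x y mx my j lt_ji; rewrite rmorphD /= coefD (mx _ lt_ji) (my _ lt_ji) addr0.
- move=> i j x y mx my k lt_k; rewrite rmorphM /= coefM big1 // => -[l /= ltl] _.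
  have [ltli|leil] := ltnP l i; first by rewrite (mx _ ltli) mul0r.
  by rewrite (my (k - l)%N) ?mulr0 //; lia.
- by move=> i x mx j lt_ji; apply: mx; lia.
Qed.

Lemma mult_lin a j : mult a 1 (lin a j).
Proof.
case=> // _; rewrite linE rmorphB /= !tayZ !tayXU coefB 2!coefCM !coef0_tay_var.
by rewrite !mul_mpolyC !scalerA mulrC subrr.
Qed.

Lemma mult_ideal_pow_lin a m f :
  ideal_pow (fun g => exists j, g = lin a j) m f -> mult a m f.
Proof.
apply: ideal_pow_sub_filtration; first exact: mult_filtration.
by move=> _ [j ->]; exact: mult_lin.
Qed.

Definition homogp (d : nat) (p : {poly {mpoly A[N.+1]}}) : Prop :=
  forall i, p`_i \is d.-homog.

Lemma homogpM d e p q : homogp d p -> homogp e q -> homogp (d + e) (p * q).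
Proof.
by move=> hp hq i; rewrite coefM; apply: rpred_sum => j _; exact: dhomogM.
Qed.

Lemma homogp_tay a f d : f \is d.-homog -> homogp d (tay a f).
Proof.
have h1 : homogp 0 1 by case=> [|i]; rewrite coef1 /= ?dhomog1 ?dhomog0.
have hv j : homogp 1 (tay_var a j).
  have hX k : ('X_k : {mpoly A[N.+1]}) \is 1.-homog by rewrite dhomogX /= mdeg1.
  move=> i; rewrite tay_varE; case: ifP => _; first exact: dhomogZ.
  case: ifP => _; last exact: dhomog0.
  by rewrite linE; apply: rpredB; exact: dhomogZ.
have hX mu : homogp (mdeg mu) (tay a 'X_[mu]).
  rewrite tayX mdegE; elim/big_rec2: _ => // j d' p _ IH; apply: homogpM => //.
  elim: (mu j) => [|k IHk]; first exact: h1.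
  by rewrite exprS -add1n; exact: homogpM.
move=> /dhomogP hf i; rewrite [f]mpolyE rmorph_sum /= coef_sum.
rewrite big_seq; apply: rpred_sum => mu /hf <-; rewrite tayZ coefCM mul_mpolyC.
by apply: dhomogZ; exact: hX.
Qed.

(** All coefficients of [tay a g] are homogeneous of the same degree as a homogeneous [g], so taking
    components commutes with [tay a]. *)
Lemma mult_pihomog a m d f : mult a m f -> mult a m (pihomog mdeg d f).
Proof.
move=> mf i lt_im; have := mf i lt_im.
have [led|ltd] := leqP (msize f) d.
  move=> _; suff -> : pihomog mdeg d f = 0 by rewrite rmorph0 coef0.
  rewrite pihomogE big_seq_cond big1 // => mu /andP[/msize_mdeg_lt ltmu /eqP eqd].
  by rewrite eqd in ltmu; lia.
rewrite {1}(pihomog_partitionE (leqnn (mmeasure mdeg f))) rmorph_sum coef_sum.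
move/(congr1 (pihomog mdeg d)); rewrite raddf0 raddf_sum /=.
rewrite (bigD1 (Ordinal ltd)) //= big1 ?addr0 => [|e neq].
  by rewrite pihomog_dE //; apply: homogp_tay; exact: pihomogP.
by apply: (@pihomog_ne0 _ _ _ e) => //; apply: homogp_tay; exact: pihomogP.
Qed.

Lemma coef0_tay a f d : f \is d.-homog -> (tay a f)`_0 = f.@[a] *: 'X_ord0 ^+ d.
Proof.
move=> /dhomogP /= hf0.
have hf mu : mu \in msupp f -> mdeg mu = d by exact: hf0.
rewrite {1}[f]mpolyE rmorph_sum /= coef_sum mevalE scaler_suml.
rewrite !big_seq; apply: eq_bigr => mu /hf <-.
rewrite tayZ coefCM mul_mpolyC -scalerA tayX coef0_prod; congr (_ *: _).
rewrite mdegE expr_sum -scaler_prod; apply: eq_bigr => j _.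
by rewrite -exprZn -coef0_tay_var; elim: (mu j) => [|k IH]; rewrite ?coef1 // !exprS coef0M IH.
Qed.

Lemma tay_at1 a f d : f \is d.-homog -> (tay a f).[1] = a ord0 ^+ d *: f.
Proof.
move=> /dhomogP /= hf0.
have hf mu : mu \in msupp f -> mdeg mu = d by exact: hf0.
rewrite {1}[f]mpolyE rmorph_sum /= horner_sum [in RHS](mpolyE f) scaler_sumr.
rewrite !big_seq; apply: eq_bigr => mu /hf <-.
rewrite tayZ hornerM hornerC mul_mpolyC scalerA mulrC -scalerA; congr (_ *: _).
rewrite tayX horner_prod mpolyXE_id mdegE expr_sum -scaler_prod.
by apply: eq_bigr => j _; rewrite horner_exp tay_var1 exprZn.
Qed.

(** In [tay_var a j] the variable 'X comes with the factor [lin a j], so 'X^i comes with i such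
    factors. *)
Lemma filtration_tay (J : nat -> {mpoly A[N.+1]} -> Prop) a f :
  filtration J -> (forall j, J 1%N (lin a j)) -> forall i, J i (tay a f)`_i.
Proof.
move=> FJ Jl; case: (FJ) => J0 J00 JD JM _ i.
have Jv j k : J k (tay_var a j)`_k.
  by rewrite tay_varE; case: k => [|[|k]] //=.
rewrite [f]mpolyE rmorph_sum /= coef_sum; apply: filtration_sum => // mu _.
rewrite tayZ coefCM -[X in J X _]add0n; apply: JM => //.
rewrite tayX; move: i; elim/big_ind: _ => [i|p q Jp Jq i|j _ i].
- by rewrite coef1; case: i => [|i] /=.
- exact: filtration_coefM.
- exact: filtration_coefXn.
Qed.

End Taylor.

Lemma tay_map (A B : comNzRingType) (N : nat) (phi : {rmorphism A -> B})
    (a : 'I_N.+1 -> A) (f : {mpoly A[N.+1]}) :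
  tay (phi \o a) (map_mpoly phi f) = map_poly (map_mpoly phi) (tay a f).
Proof.
have hv j : tay_var (phi \o a) j = map_poly (map_mpoly phi) (tay_var a j).
  rewrite tay_var.unlock !linE [RHS]rmorphD [X in _ = _ + X]rmorphM /= map_polyX !map_polyC /=
    [map_mpoly phi (_ - _)]rmorphB /=.
  by rewrite !map_mpolyZ !map_mpolyX.
rewrite [f]mpolyE [map_mpoly phi _]rmorph_sum !rmorph_sum /=; apply: eq_bigr => mu _.
rewrite map_mpolyZ !tayZ rmorphM /= map_polyC /= map_mpolyC; congr (_ * _).
rewrite map_mpolyX !tayX rmorph_prod; apply: eq_bigr => j _ /=.
by rewrite hv rmorphXn.
Qed.

Section TaylorField.

Variables (k : fieldType) (N : nat).
Implicit Types (a : 'I_N.+1 -> k) (f g : {mpoly k[N.+1]}).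

Lemma mult1_homog a f d : f \is d.-homog -> f.@[a] = 0 -> mult a 1 f.
Proof. by move=> hf fa [] // _; rewrite (coef0_tay _ hf) fa scale0r. Qed.

Lemma mult_cancel a m f g d : f \is d.-homog -> f.@[a] != 0 ->
  mult a m (f * g) -> mult a m g.
Proof.
move=> hf fa mfg; apply: (@coef_mul_eq0 _ (tay a f)).
  by rewrite (coef0_tay _ hf) mscalerI (negbTE fa) expf_eq0 -msize_poly_eq0 msizeX andbF.
by move=> i /mfg; rewrite rmorphM.
Qed.

(** At 'X = 1 the Taylor polynomial of a component of degree [d] is that component times [a_0^d].
    Its coefficients below [m] vanish and the i-th one lies in [J i]. For [J] the powers of the
    ideal of linear forms, multiplicity becomes membership in a power. *)
Lemma mult_in_filtration (J : nat -> {mpoly k[N.+1]} -> Prop) a m f :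
    filtration J -> (forall j, J 1%N (lin a j)) -> a ord0 != 0 -> mult a m f ->
  J m f.
Proof.
move=> FJ Jl a0 mf; case: (FJ) => J0 J00 _ JM _.
rewrite (pihomog_partitionE (leqnn (mmeasure mdeg f))); apply: filtration_sum => // d _.
set g := pihomog mdeg d f; have hg : g \is d.-homog by exact: pihomogP.
have mg : mult a m g by exact: mult_pihomog.
have -> : g = (a ord0 ^- d)%:MP * (tay a g).[1].
  by rewrite (tay_at1 _ hg) mul_mpolyC scalerA mulVf ?scale1r // expf_neq0.
rewrite -[m]add0n; apply: JM => //; rewrite horner_coef.
apply: filtration_sum => // -[i _] _ /=; rewrite expr1n mulr1.
have [lt_im|le_mi] := ltnP i m; first by rewrite mg.
by apply: (filtration_le FJ le_mi); exact: filtration_tay.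
Qed.

Lemma lin_homog a j : lin a j \is 1.-homog.
Proof. by rewrite linE; apply: rpredB; apply: dhomogZ; rewrite dhomogX /= mdeg1. Qed.

Lemma lin_eval a b j : (lin a j).@[b] = a ord0 * b j - a j * b ord0.
Proof. by rewrite linE mevalB !mevalZ !mevalXU. Qed.

Lemma lin_eval0 a j : (lin a j).@[a] = 0.
Proof. by rewrite lin_eval mulrC subrr. Qed.

End TaylorField.

(** * Symbolic and ordinary powers in high degree *)

Lemma meval_homogZ (k : fieldType) (n d : nat) (f : {mpoly k[n]}) (v w : 'I_n -> k) c :
  f \is d.-homog -> (forall j, w j = c * v j) -> f.@[w] = c ^+ d * f.@[v].
Proof.
move=> /dhomogP /= hf0 wE; have hf mu : mu \in msupp f -> mdeg mu = d by exact: hf0.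
rewrite !mevalE mulr_sumr !big_seq; apply: eq_bigr => mu /hf <-.
rewrite mulrCA mdegE expr_sum -big_split; congr (_ * _); apply: eq_bigr => j _ /=.
by rewrite wE exprMn.
Qed.

Lemma pihomogM (k : fieldType) (n d e : nat) (l q : {mpoly k[n]}) :
  l \is e.-homog -> pihomog mdeg (e + d) (l * q) = l * pihomog mdeg d q.
Proof.
move=> hl; set K := (msize q + d.+1)%N.
have leK : (mmeasure mdeg q <= K)%N by exact: leq_addr.
have ltdK : (d < K)%N by rewrite /K; lia.
rewrite {1}(pihomog_partitionE leK) mulr_sumr raddf_sum /=.
rewrite (bigD1 (Ordinal ltdK)) //= big1 => [|c neq].
  by rewrite addr0 pihomog_dE //; apply: dhomogM => //; exact: pihomogP.
apply: (@pihomog_ne0 _ _ _ (e + c)); last by apply: dhomogM => //; exact: pihomogP.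
by rewrite eqn_add2l.
Qed.

(** Multiplicity one puts [f] in the ideal of the linear forms; the cofactors are replaced by their
    components of degree [d]. *)
Lemma homog_vanish_lin (k : fieldType) (N d : nat) (b : 'I_N.+1 -> k)
    (f : {mpoly k[N.+1]}) :
  b ord0 != 0 -> f \is d.+1.-homog -> f.@[b] = 0 ->
  exists n (l q : 'I_n -> {mpoly k[N.+1]}),
    [/\ forall t, l t \is 1.-homog, forall t, (l t).@[b] = 0,
        forall t, q t \is d.-homog & f = \sum_(t < n) l t * q t].
Proof.
move=> b0 hf fb.
have : ideal_pow (fun g => exists j, g = lin b j) 1 f.
  apply: (@mult_in_filtration _ _ _ b) => //; first exact: ideal_pow_filtration.
    by move=> j; apply: ideal_pow1; exists j.
  exact: mult1_homog hf fb.
case=> n [c [g [gE fE]]].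
have lE t : exists j, g t = lin b j.
  by have [h [hj ->]] := gE t; have [j hjE] := hj ord0; exists j; rewrite big_ord1.
exists n, g, (fun t => pihomog mdeg d (c t)); split=> [t|t|t|].
- by have [j ->] := lE t; exact: lin_homog.
- by have [j ->] := lE t; exact: lin_eval0.
- exact: pihomogP.
rewrite -(pihomog_dE hf) fE raddf_sum /=; apply: eq_bigr => t _.
by rewrite mulrC -[d.+1]add1n pihomogM //; have [j ->] := lE t; exact: lin_homog.
Qed.

Lemma mnm_split (n d : nat) (mu : 'X_{1..n}) : (d <= mdeg mu)%N ->
  exists nu1 nu2 : 'X_{1..n}, mu = (nu1 + nu2)%MM /\ mdeg nu1 = d.
Proof.
elim: d => [|d IH] led; first by exists 0%MM, mu; rewrite add0m mdeg0.
have [nu1 [nu2 [muE dE]]] := IH (ltnW led).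
have : (0 < mdeg nu2)%N by move: led; rewrite muE mdegD dE; lia.
rewrite lt0n mdeg_eq0 => nz.
have [j nzj] : exists j, nu2 j != 0%N.
  by apply/existsP; apply: contraR nz => /existsPn z; apply/eqP/mnmP => j; rewrite mnm0E; move: (z j); case: (nu2 j).
exists (nu1 + U_(j))%MM, (nu2 - U_(j))%MM; split; last by rewrite mdegD mdeg1 dE addn1.
apply/mnmP => t; rewrite muE !mnmDE mnmBE mnm1E; have [<-|_] := eqVneq j t => /=; lia.
Qed.

(** * Products of separators and of forms of degree r *)

Section Separators.

Variables (k : fieldType) (N s rho : nat) (a : 'I_s -> 'I_N.+1 -> k).
Variable (F : 'I_s -> {mpoly k[N.+1]}).
Hypothesis a0 : forall i, a i ord0 != 0.
Hypothesis hF : forall i, F i \is rho.-homog.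
Hypothesis FE : forall i j, (F i).@[a j] = (i == j)%:R.

Local Notation I := (points_ideal a).
Local Notation mpo := {mpoly k[N.+1]}.

(** The part of the ideal in degree [r = rho + 1]. With the forms [sep0 i] it spans all forms of
    degree [r], by [base_form_sub]. *)
Definition base_form (w : mpo) : Prop :=
  w \is rho.+1.-homog /\ forall j, w.@[a j] = 0.

Definition sep0 i : mpo := F i * 'X_ord0.

Definition sep_lin i (x : mpo) : Prop :=
  exists lam, [/\ lam \is 1.-homog, lam.@[a i] = 0 & x = F i * lam].

Lemma X0_homog : ('X_ord0 : mpo) \is 1.-homog.
Proof. by rewrite dhomogX /= mdeg1. Qed.

Lemma base_form_ideal w : base_form w -> I w.
Proof. by case=> hw w0; apply: ideal_gen_mem; exists rho.+1. Qed.

Lemma base_form_lin i l : l \is 1.-homog -> l.@[a i] = 0 -> base_form (F i * l).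
Proof.
move=> hl li; split=> [|j]; first by rewrite -[rho.+1]addn1; exact: dhomogM.
by rewrite mevalM FE; have [<-|_] := eqVneq; rewrite ?li ?mulr0 ?mul0r.
Qed.

Lemma sep_lin_base i x : sep_lin i x -> base_form x.
Proof. by case=> l [hl li ->]; exact: base_form_lin. Qed.

Lemma sep0_homog i : sep0 i \is rho.+1.-homog.
Proof. by rewrite -[rho.+1]addn1; apply: dhomogM => //; exact: X0_homog. Qed.

Lemma base_form_sub f : f \is rho.+1.-homog ->
  base_form (f - \sum_j (f.@[a j] / a j ord0) *: sep0 j).
Proof.
move=> hf; split=> [|j].
  by apply: rpredB => //; apply: rpred_sum => j _; apply: dhomogZ; exact: sep0_homog.
rewrite mevalB (raddf_sum (meval (a j))) /= (bigD1 j) //= big1 => [|i neq].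
  by rewrite addr0 mevalZ mevalM FE eqxx mul1r mevalXU divfK ?subrr.
by rewrite mevalZ mevalM FE (negbTE neq) mul0r mulr0.
Qed.

(** Otherwise [a j] would be a multiple of [a i], and [F j], which vanishes at [a i], would vanish
    at [a j]. *)
Lemma separated i j : i != j -> exists t, (lin (a i) t).@[a j] != 0.
Proof.
move=> neq; apply: NNPP => abs.
have E t : a j t = (a j ord0 / a i ord0) * a i t.
  have [//|nz] := eqVneq (lin (a i) t).@[a j] 0; last by case: abs; exists t.
  move=> /eqP; rewrite lin_eval subr_eq0 => /eqP E.
  by apply: (mulfI (a0 i)); rewrite E mulrCA !mulrA divfK // mulrC.
have := FE j j; rewrite eqxx (meval_homogZ (hF j) E) FE eq_sym (negbTE neq) mulr0.
by move/eqP; rewrite eq_sym oner_eq0.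
Qed.

Lemma split_X0 i j : i != j -> exists mu nu : mpo,
  [/\ mu \is 1.-homog, nu \is 1.-homog, mu.@[a i] = 0, nu.@[a j] = 0
    & 'X_ord0 = mu + nu].
Proof.
move=> neq; have [t nz] := separated neq.
(* Scaled to agree with x_0 at [a j]. *)
pose mu := (a j ord0 / (lin (a i) t).@[a j]) *: lin (a i) t.
have hmu : mu \is 1.-homog by apply: dhomogZ; exact: lin_homog.
exists mu, ('X_ord0 - mu); split=> //.
- by apply: rpredB => //; exact: X0_homog.
- by rewrite mevalZ lin_eval0 mulr0.
- by rewrite mevalB mevalXU mevalZ divfK ?subrr.
- by rewrite addrC subrK.
Qed.

(** One factor x_0 is split as [mu + nu]; [mu] completes [F i] to a base form and [nu] completes
    [F j]. *)
Lemma sep0_mul i j : i != j -> exists w w',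
  [/\ base_form w, base_form w' & sep0 i * sep0 j = w * sep0 j + w' * sep0 i].
Proof.
move=> /split_X0[mu [nu [hmu hnu mui nuj E]]].
exists (F i * mu), (F j * nu); split; [exact: base_form_lin..|].
by rewrite /sep0; rewrite {2}E; ring.
Qed.

(** Write [w] as the sum of the [l_t q_t] with [l_t] linear and zero at [a i], and reduce each
    [q_t x_0] modulo base forms to a combination of the [sep0 j]. There remain the terms
    [F i * sep0 j * lam j], where [lam j] vanishes at [a i] because the [l_t] do, and at [a j]
    because [w] does. For [j != i], splitting x_0 makes such a term a sum of two products of base
    forms; the term [j = i] is the remainder. *)
Lemma base_form_sep0 i w : base_form w -> exists2 x, sep_lin i x
  & ideal_pow base_form 2 (w * sep0 i - x * sep0 i).
Proof.
case=> hw w0; have [n [l [q [hl li hq wE]]]] := homog_vanish_lin (a0 i) hw (w0 i).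
pose lam j := \sum_t (q t).@[a j] *: l t.
have hlam j : lam j \is 1.-homog by apply: rpred_sum => t _; exact: dhomogZ.
have lami j : (lam j).@[a i] = 0.
  by rewrite (raddf_sum (meval (a i))) big1 // => t _; rewrite /= mevalZ li mulr0.
have lamj j : (lam j).@[a j] = 0.
  rewrite -(w0 j) wE !(raddf_sum (meval (a j))) /=; apply: eq_bigr => t _.
  by rewrite mevalZ mevalM mulrC.
have hu t : q t * 'X_ord0 \is rho.+1.-homog.
  by rewrite -[rho.+1]addn1; apply: dhomogM => //; exact: X0_homog.
pose v t := q t * 'X_ord0 - \sum_j (q t).@[a j] *: sep0 j.
have Wv t : base_form (v t).
  have := base_form_sub (hu t); rewrite /v; congr (base_form (_ - _)).
  by apply: eq_bigr => j _; rewrite mevalM mevalXU mulfK.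
have E : w * sep0 i = \sum_t (F i * l t) * v t + \sum_j F i * sep0 j * lam j.
  have -> : \sum_j F i * sep0 j * lam j =
      \sum_t F i * l t * \sum_j (q t).@[a j] *: sep0 j.
    transitivity (\sum_j \sum_t F i * l t * ((q t).@[a j] *: sep0 j)).
      apply: eq_bigr => j _; rewrite mulr_sumr; apply: eq_bigr => t _.
      by rewrite -!scalerAr mulrAC.
    by rewrite exchange_big; apply: eq_bigr => t _; rewrite mulr_sumr.
  rewrite -big_split wE mulr_suml; apply: eq_bigr => t _ /=.
  by rewrite -mulrDr /v subrK /sep0; ring.
exists (F i * lam i); first by exists (lam i); split.
have -> : w * sep0 i - F i * lam i * sep0 i =
    \sum_t (F i * l t) * v t + \sum_(j | j != i) F i * sep0 j * lam j.
  by rewrite E (bigD1 i) //= [F i * sep0 i * _]mulrAC addrCA addrAC subrr add0r.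
have W2 x y : base_form x -> base_form y -> ideal_pow base_form 2 (x * y).
  by move=> Wx Wy; apply: (@ideal_powM _ _ 1 1); exact: ideal_pow1.
apply: ideal_genD; [apply: ideal_gen_sum => t _|apply: ideal_gen_sum => j neq].
  by apply: W2 => //; exact: base_form_lin.
have /split_X0[mu [nu [hmu hnu mui nuj X0E]]] : i != j by rewrite eq_sym.
have -> : F i * sep0 j * lam j = (F i * mu) * (F j * lam j) + (F i * lam j) * (F j * nu).
  by rewrite /sep0 X0E; ring.
by apply: ideal_genD; apply: W2; exact: base_form_lin.
Qed.

(** The ideal [I^b + (F_1^b, ..., F_s^b)], which contains every form of degree at least [b r]. *)
Definition sep_ideal b (f : mpo) : Prop :=
  exists y g, ideal_pow I b y /\ f = y + \sum_i F i ^+ b * g i.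

Lemma sep_ideal_pow b y : ideal_pow I b y -> sep_ideal b y.
Proof.
by move=> Iy; exists y, (fun _ => 0); split=> //; rewrite big1 ?addr0 // => i _; rewrite mulr0.
Qed.

Lemma sep_ideal0 b : sep_ideal b 0.
Proof. by apply: sep_ideal_pow; exact: ideal_gen0. Qed.

Lemma sep_idealD b f g : sep_ideal b f -> sep_ideal b g -> sep_ideal b (f + g).
Proof.
case=> y [u [Iy ->]] [z [v [Iz ->]]]; exists (y + z), (fun i => u i + v i).
split; first exact: ideal_genD.
by rewrite addrACA -big_split; congr (_ + _); apply: eq_bigr => i _; rewrite mulrDr.
Qed.

Lemma sep_idealM b c f : sep_ideal b f -> sep_ideal b (c * f).
Proof.
case=> y [u [Iy ->]]; exists (c * y), (fun i => c * u i); split; first exact: ideal_genM.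
by rewrite mulrDr mulr_sumr; congr (_ + _); apply: eq_bigr => i _; rewrite mulrCA.
Qed.

Lemma sep_ideal_sum b (T : Type) (r : seq T) (Q : pred T) (f : T -> mpo) :
  (forall i, Q i -> sep_ideal b (f i)) -> sep_ideal b (\sum_(i <- r | Q i) f i).
Proof. by move=> Tf; elim/big_ind: _ => //; [exact: sep_ideal0 | exact: sep_idealD]. Qed.

Lemma sep_ideal_F b i g : sep_ideal b (F i ^+ b * g).
Proof.
exists 0, (fun j => if j == i then g else 0); split; first exact: ideal_gen0.
rewrite add0r (bigD1 i) //= eqxx big1 ?addr0 // => j /negbTE ->.
by rewrite mulr0.
Qed.

Lemma sep_lin_pow i m x : ideal_pow (sep_lin i) m x -> exists c, x = F i ^+ m * c.
Proof.
elim: m x => [|m IH] x; first by exists x; rewrite mul1r.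
move: x; apply: ideal_pow_recl => [|_ _ [c ->] [d ->]|_ y [lam [_ _ ->]] /IH[c ->]].
- by exists 0; rewrite mulr0.
- by exists (c + d); rewrite mulrDr.
- by exists (lam * c); rewrite exprS; ring.
Qed.

(* Each application of [base_form_sep0] either turns a factor [sep0 i] into a base
   form, or a base form into an element of [sep_lin i]. *)
Lemma sep_ideal_sep0X b i m n e x y : (e + n + m = b)%N ->
    ideal_pow (sep_lin i) e x -> ideal_pow base_form n y ->
  sep_ideal b (x * y * sep0 i ^+ m).
Proof.
have W_I u d : ideal_pow base_form d u -> ideal_pow I d u.
  by apply: ideal_powS; exact: base_form_ideal.
have X_W u d : ideal_pow (sep_lin i) d u -> ideal_pow base_form d u.
  by apply: ideal_powS; exact: sep_lin_base.
elim: m n e x y => [|m IHm] n.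
  move=> e x y <- Xx Wy; rewrite mulr1 addn0; apply: sep_ideal_pow; apply: W_I.
  by apply: ideal_powM => //; exact: X_W.
elim: n => [|n IHn] e x y eb Xx.
  (* No base form is left: [e + (m + 1) = b], and each of these [b] factors contains [F i]. *)
  move=> _; have [c ->] := sep_lin_pow Xx.
  suff -> : F i ^+ e * c * y * sep0 i ^+ m.+1 = F i ^+ b * (c * y * 'X_ord0 ^+ m.+1).
    exact: sep_ideal_F.
  by rewrite /sep0 exprMn -eb addn0 exprD; ring.
move: y; apply: ideal_pow_recl => [|y z|w y Ww Wy].
- by rewrite mulr0 mul0r; exact: sep_ideal0.
- by rewrite mulrDr mulrDl; exact: sep_idealD.
have [z Xz W2] := base_form_sep0 i Ww.
have -> : x * (w * y) * sep0 i ^+ m.+1 =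
    1 * (x * y * (w * sep0 i - z * sep0 i)) * sep0 i ^+ m + (x * z) * y * sep0 i ^+ m.+1.
  by rewrite exprS; ring.
apply: sep_idealD.
  apply: (IHm (e + n + 2)%N 0%N); [by lia | exact: ideal_pow0 |].
  by apply: ideal_powM => //; apply: ideal_powM => //; exact: X_W.
apply: (IHn (e + 1)%N) => //; first by lia.
by apply: ideal_powM => //; exact: ideal_pow1.
Qed.

(** Two distinct indices are traded for a base form and one index by [sep0_mul]; once all indices
    agree the product is a power of one [sep0 i]. *)
Lemma sep_ideal_prod b n y (r : seq 'I_s) : (n + size r = b)%N ->
  ideal_pow base_form n y -> sep_ideal b (y * \prod_(i <- r) sep0 i).
Proof.
have [m] := ubnP (size r); elim: m r n y => // m IH [|i r] n y ltm eb Wy.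
  rewrite big_nil mulr1; apply: sep_ideal_pow; rewrite -eb addn0.
  by apply: ideal_powS Wy; exact: base_form_ideal.
have [/all_pred1P rE|/allPn[j jr /= neq]] := boolP (all (pred1 i) r).
  rewrite rE big_cons big_nseq -Monoid.iteropE -/(_ ^+ size r) -exprS -[y]mul1r.
  apply: sep_ideal_sep0X (ideal_pow0 _ _) Wy.
  by rewrite -eb.
have rp : perm_eq (i :: r) [:: i, j & rem j r] by rewrite perm_cons perm_to_rem.
have sz : size r = (size (rem j r)).+1.
  by rewrite size_rem // prednK //; case: (r) jr.
rewrite (perm_big _ rp) /= !big_cons [sep0 i * _]mulrA.
have /sep0_mul[w [w' [Ww Ww' ->]]] : i != j by rewrite eq_sym.
have -> : y * ((w * sep0 j + w' * sep0 i) * \prod_(j0 <- rem j r) sep0 j0) =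
    (y * w) * \prod_(t <- j :: rem j r) sep0 t
    + (y * w') * \prod_(t <- i :: rem j r) sep0 t.
  by rewrite !big_cons; ring.
move: ltm eb; rewrite /= sz => ltm eb.
by apply: sep_idealD; apply: (IH _ (n + 1)%N) => //=;
  first [by rewrite -eb addn1 addSnnS
        | by apply: ideal_powM => //; exact: ideal_pow1].
Qed.

(** Here [c] counts the factors of degree [r] still to be split off the monomial; each of them
    becomes a base form plus a combination of the [sep0 j]. *)
Lemma sep_ideal_monomial b c n y (r : seq 'I_s) mu :
    (n + size r + c = b)%N -> (c * rho.+1 <= mdeg mu)%N ->
    ideal_pow base_form n y ->
  sep_ideal b (y * \prod_(i <- r) sep0 i * 'X_[mu]).
Proof.
elim: c n y r mu => [|c IH] n y r mu eb lec Wy.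
  by rewrite mulrC; apply: sep_idealM; apply: sep_ideal_prod Wy; lia.
have [nu1 [nu2 [muE hnu1]]] : exists nu1 nu2 : 'X_{1..N.+1},
    mu = (nu1 + nu2)%MM /\ mdeg nu1 = rho.+1.
  by apply: mnm_split; lia.
move: lec; rewrite muE mdegD hnu1 mulSn leq_add2l => lec; rewrite mpolyXD.
have hX : ('X_[nu1] : mpo) \is rho.+1.-homog by rewrite dhomogX; apply/eqP.
have /= := base_form_sub hX; set S := \sum_j _ => WX.
have -> : 'X_[nu1] = ('X_[nu1] - S) + S :> mpo by rewrite subrK.
rewrite mulrDl mulrDr; apply: sep_idealD.
  have -> : forall w p x : mpo, y * p * (w * x) = y * w * p * x by move=> *; ring.
  apply: (IH (n + 1)%N); [by lia | exact: lec |].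
  by apply: ideal_powM => //; exact: ideal_pow1.
rewrite mulr_suml mulr_sumr; apply: sep_ideal_sum => j _.
have -> : y * \prod_(i <- r) sep0 i * ((meval (a j) 'X_[nu1] / a j ord0) *: sep0 j * 'X_[nu2]) =
   (meval (a j) 'X_[nu1] / a j ord0)%:MP * (y * \prod_(i <- j :: r) sep0 i * 'X_[nu2]).
  by rewrite big_cons -mul_mpolyC; ring.
apply: sep_idealM; apply: IH => //.
  by rewrite -eb /= addnS addSnnS.
exact: Wy.
Qed.

Lemma homog_sep_ideal b t f :
  (b * rho.+1 <= t)%N -> f \is t.-homog -> sep_ideal b f.
Proof.
move=> let_ /dhomogP hf; rewrite [f]mpolyE big_seq; apply: sep_ideal_sum => mu /hf /= hmu.
rewrite -mul_mpolyC; apply: sep_idealM.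
rewrite -['X_[mu]]mul1r -[1]mul1r -{2}(big_nil 1 *%R xpredT sep0).
apply: (@sep_ideal_monomial b b 0) => //; last exact: ideal_pow0.
by rewrite hmu.
Qed.

Lemma sep_point_pow i m g :
  ideal_pow (fun f => exists j, f = lin (a i) j) m g -> ideal_pow I m (F i ^+ m * g).
Proof.
elim: m g => [|m IH] g; first by move=> _; exact: ideal_pow0.
move: g; apply: ideal_pow_recl => [|x y|_ y [j ->] /IH Iy].
- by rewrite mulr0; exact: ideal_gen0.
- by rewrite mulrDr; exact: ideal_genD.
rewrite exprS mulrACA -[m.+1]add1n; apply: ideal_powM => //; apply: ideal_pow1.
by apply: base_form_ideal; apply: base_form_lin; [exact: lin_homog | exact: lin_eval0].
Qed.

Lemma mult_points_ideal i b y : ideal_pow I b y -> mult (a i) b y.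
Proof.
apply: ideal_pow_sub_filtration; first exact: mult_filtration.
have [_ M0 MD MM _] := mult_filtration (a i).
apply: ideal_gen_ind => // [x z|c x [d [hx x0]]]; first exact: MD.
by apply: (MM 0%N 1%N) => //; apply: mult1_homog hx _.
Qed.

(** In [f = y + sum_j F_j^b g_j] all terms but [F_i^b g_i] have multiplicity [b] at [a i], so this
    one has it too. As [F i] does not vanish there, [g_i] has multiplicity [b], hence lies in the
    b-th power of the linear forms at [a i], and [F i] times such a linear form is in [I]. *)
Theorem homog_mult_in_pow b t f : (b * rho.+1 <= t)%N -> f \is t.-homog ->
  (forall i, mult (a i) b f) -> ideal_pow I b f.
Proof.
move=> let_ hf mf; have [y [g [Iy fE]]] := homog_sep_ideal let_ hf.
rewrite fE; apply: ideal_genD => //; apply: ideal_gen_sum => i _.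
apply: sep_point_pow.
apply: (mult_in_filtration (ideal_pow_filtration _) _ (a0 i)) => [j|].
  by apply: ideal_pow1; exists j.
have [_ _ MD MM _] := mult_filtration (a i).
have mN x : mult (a i) b x -> mult (a i) b (- x).
  by move=> mx; rewrite -mulN1r; apply: (MM 0%N b).
apply: (@mult_cancel _ _ _ _ (F i ^+ b) _ (rho * b)%N); first exact: dhomogMn.
  by rewrite rmorphXn /= FE eqxx expr1n oner_eq0.
have -> : F i ^+ b * g i = f - y - \sum_(j | j != i) F j ^+ b * g j.
  by rewrite fE (bigD1 i) //=; ring.
apply: (MD); first by apply: (MD) => //; apply: mN; exact: mult_points_ideal.
apply: mN; apply: filtration_sum => [|j neq]; first exact: mult_filtration.
have mF : mult (a i) 1 (F j).
  by apply: mult1_homog (hF j) _; rewrite FE (negbTE neq).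
have := filtrationX b (mult_filtration (a i)) mF; rewrite mul1n => mFb.
by have := MM b 0%N _ (g j) mFb; rewrite addn0; apply.
Qed.

End Separators.

(** * Multiplicities in positive characteristic *)

Lemma pchar_nat_exp (S : nzSemiRingType) p v : p \in [pchar S] -> [pchar S].-nat (p ^ v)%N.
Proof. by move=> hp; rewrite pnatX pnatE ?hp // (pcharf_prime hp). Qed.

Lemma exprBn_pchar (S : comNzRingType) p v (x y : S) : p \in [pchar S] ->
  (x - y) ^+ (p ^ v)%N = x ^+ (p ^ v)%N - y ^+ (p ^ v)%N.
Proof.
by move=> /(@pchar_nat_exp _ _ v) hp; rewrite exprDn_pchar // exprNn_pchar.
Qed.

Section FrobeniusRoot.

Variables (Om : closedFieldType) (p v : nat).
Hypothesis pcharOm : p \in [pchar Om].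
Local Notation q := (p ^ v)%N.

Lemma frob_exp_gt0 : (0 < q)%N.
Proof. by rewrite expn_gt0 prime_gt0 // (pcharf_prime pcharOm). Qed.

Lemma frob_root_exists (c : Om) : exists x, root ('X^q - c%:P) x.
Proof. by apply/closed_rootP; rewrite size_XnsubC ?frob_exp_gt0 // eqSS -lt0n frob_exp_gt0. Qed.

Definition frob_root (c : Om) : Om := xchoose (frob_root_exists c).

Lemma frob_rootK c : frob_root c ^+ q = c.
Proof. by have := xchooseP (frob_root_exists c); rewrite rootE !hornerE subr_eq0 => /eqP. Qed.

Lemma frob_inj (x y : Om) : x ^+ q = y ^+ q -> x = y.
Proof.
move=> /eqP; rewrite -subr_eq0 -exprBn_pchar // expf_eq0 subr_eq0.
by case/andP=> _ /eqP.
Qed.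

Lemma frob_rootD x y : frob_root (x + y) = frob_root x + frob_root y.
Proof.
by apply: frob_inj; rewrite exprDn_pchar ?pchar_nat_exp // !frob_rootK.
Qed.

Lemma frob_rootM x y : frob_root (x ^+ q * y) = x * frob_root y.
Proof. by apply: frob_inj; rewrite exprMn !frob_rootK. Qed.

Lemma frob_root_eq0 x : (frob_root x == 0) = (x == 0).
Proof. by rewrite -[x in RHS]frob_rootK expf_eq0 frob_exp_gt0. Qed.

Lemma frob_root0 : frob_root 0 = 0.
Proof. by apply/eqP; rewrite frob_root_eq0. Qed.

Variable n : nat.
Implicit Types (f g : {mpoly Om[n]}) (mu al : 'X_{1..n}).

(* [cartier mu f] collects the q-th roots of the coefficients of [f] at the
   exponents congruent to [mu] modulo q: f = \sum_mu (cartier mu f)^q x^mu. *)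
Definition cartier mu f : {mpoly Om[n]} :=
  \sum_(al : 'X_{1..n < msize f}) frob_root f@_(al *+ q + mu) *: 'X_[al].

Lemma mcoeff_cartier mu f al : (cartier mu f)@_al = frob_root f@_(al *+ q + mu).
Proof.
have [ltal|geal] := ltnP (mdeg al) (msize f); first exact: (mcoeff_mpoly (fun be : 'X_{1..n} => frob_root f@_(be *+ q + mu))).
rewrite (@memN_msupp_eq0 _ _ f); last first.
  apply: msize_mdeg_ge; rewrite mdegD mdegMn; apply: (leq_trans geal).
  by rewrite (leq_trans _ (leq_addr _ _)) // leq_pmulr // frob_exp_gt0.
rewrite frob_root0 /cartier raddf_sum big1 // => -[be ltbe] _ /=.
rewrite mcoeffZ mcoeffX; have [E|_] := eqVneq be al; last by rewrite mulr0.
by rewrite E in ltbe; rewrite ltnNge geal in ltbe.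
Qed.

Lemma cartierD mu f g : cartier mu (f + g) = cartier mu f + cartier mu g.
Proof. by apply/mpolyP => al; rewrite mcoeffD !mcoeff_cartier mcoeffD frob_rootD. Qed.

Lemma cartier0 mu : cartier mu 0 = 0.
Proof. by apply/mpolyP => al; rewrite mcoeff0 mcoeff_cartier mcoeff0 frob_root0. Qed.

Lemma cartierZ mu c f : cartier mu (c ^+ q *: f) = c *: cartier mu f.
Proof. by apply/mpolyP => al; rewrite mcoeffZ !mcoeff_cartier mcoeffZ frob_rootM. Qed.

Lemma cartierN mu f : cartier mu (- f) = - cartier mu f.
Proof. by apply/eqP; rewrite -addr_eq0 -cartierD addNr cartier0. Qed.

Lemma mcoeffMX_out f mu al j : (al j < mu j)%N -> (f * 'X_[mu])@_al = 0.
Proof.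
move=> lt; apply: memN_msupp_eq0; rewrite (perm_mem (msuppMX _ _)).
by apply/mapP => -[be _ E]; move: lt; rewrite E mnmDE; lia.
Qed.

(** If [al j = 0], the coefficient on the left is taken at an exponent of x_j below [q], where a
    multiple of [x_j^q] has none; this is the role of [mu j < q]. *)
Lemma cartierX mu j f : (mu j < q)%N ->
  cartier mu ('X_j ^+ q * f) = 'X_j * cartier mu f.
Proof.
move=> ltmu; apply/mpolyP => al; rewrite mcoeff_cartier mpolyXn mulrC ['X_j * _]mulrC.
have [al0|alpos] := posnP (al j).
  rewrite (@mcoeffMX_out _ _ _ j) ?frob_root0; last first.
    by rewrite mnmDE !mulmnE mnm1E eqxx al0 mul0n mul1n.
  by rewrite (@mcoeffMX_out _ _ _ j) // mnm1E eqxx al0.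
have -> : al = (U_(j) + (al - U_(j)))%MM.
  by apply/mnmP => t; rewrite mnmDE mnmBE mnm1E; have [<-|] := eqVneq j t; lia.
set be := (al - _)%MM.
have -> : ((U_(j) + be) *+ q + mu)%MM = (U_(j) *+ q + (be *+ q + mu))%MM.
  by apply/mnmP => t; rewrite !(mnmDE, mulmnE) mulnDl addnA.
by rewrite !mcoeffMX mcoeff_cartier.
Qed.

Lemma msize_cartier mu f d : (msize f <= q * d)%N -> (msize (cartier mu f) <= d)%N.
Proof.
move=> lef; rewrite msizeE; apply/bigmax_leqP_seq => al.
rewrite mcoeff_msupp mcoeff_cartier frob_root_eq0 -mcoeff_msupp => /msize_mdeg_lt lt _.
move: (leq_trans lt lef); rewrite mdegD mdegMn => /(leq_ltn_trans (leq_addr _ _)).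
by rewrite mulnC ltn_pmul2l ?frob_exp_gt0.
Qed.

Lemma cartier_neq0 f : f != 0 ->
  exists mu, (forall j, (mu j < q)%N) /\ cartier mu f != 0.
Proof.
move=> nz; set e := mlead f.
pose mu := [multinom (e j %% q)%N | j < n]; pose al := [multinom (e j %/ q)%N | j < n].
exists mu; split=> [j|]; first by rewrite mnmE ltn_mod frob_exp_gt0.
apply: contraNneq nz => /(congr1 (mcoeff al)); rewrite mcoeff_cartier mcoeff0.
have -> : (al *+ q + mu)%MM = e by apply/mnmP => j; rewrite mnmDE mulmnE !mnmE -divn_eq.
by move=> /eqP; rewrite frob_root_eq0 mleadc_eq0.
Qed.

End FrobeniusRoot.

Section CharpBound.

Variables (Om : closedFieldType) (p N : nat).
Hypothesis pcharOm : p \in [pchar Om].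

Local Notation lins a := (fun g => exists j, g = lin a j).

Lemma cartier_lin v (mu : 'X_{1..N.+1}) (a : 'I_N.+1 -> Om) j (f : {mpoly Om[N.+1]}) :
  (forall t, (mu t < p ^ v)%N) ->
  cartier v pcharOm mu (lin a j ^+ (p ^ v)%N * f) = lin a j * cartier v pcharOm mu f.
Proof.
move=> hmu.
have pcharM : p \in [pchar {mpoly Om[N.+1]}] by exact: (rmorph_pchar (@mpolyC N.+1 Om)).
rewrite linE exprBn_pchar // !exprZn !mulrBl -!scalerAl cartierD cartierN !cartierZ.
by rewrite !cartierX.
Qed.

Lemma prod_lin_exponents (a : 'I_N.+1 -> Om) M (h : 'I_M -> {mpoly Om[N.+1]}) :
    (forall i, exists j, h i = lin a j) ->
  exists2 e : 'I_N.+1 -> nat, (\sum_j e j)%N = M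
    & \prod_i h i = \prod_j lin a j ^+ e j.
Proof.
elim: M h => [|M IH] h hE.
  by exists (fun _ => 0%N); rewrite ?big_ord0 ?big1.
have [e eM eE] := IH (fun i => h (lift ord0 i)) (fun i => hE _).
have [j jE] := hE ord0; exists (fun t => (t == j) + e t)%N.
  by rewrite big_split /= eM -(big_mkcond (pred1 j) (fun=> 1%N)) /= big_pred1_eq add1n.
rewrite big_ord_recl eE jE [RHS](eq_bigr (fun t => lin a t ^+ (t == j) * lin a t ^+ e t)); last first.
  by move=> t _; rewrite exprD.
rewrite big_split /= [X in _ = X * _](bigD1 j) //= eqxx expr1.
by rewrite [X in _ = _ * X * _]big1 ?mulr1 // => t /negbTE ->; rewrite expr0.
Qed.

(** In a product of [(m + N) q] linear forms with exponents [e_j], the N + 1 remainders modulo [q]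
    add up to less than [(N + 1) q], so the quotients add up to at least [m]. The q-th powers come
    out of [cartier] as plain factors. *)
Lemma cartier_ideal_pow v (mu : 'X_{1..N.+1}) (a : 'I_N.+1 -> Om) m (f : {mpoly Om[N.+1]}) :
    (forall t, (mu t < p ^ v)%N) ->
    ideal_pow (lins a) ((m + N) * p ^ v) f ->
  ideal_pow (lins a) m (cartier v pcharOm mu f).
Proof.
move=> hmu; have q_gt0 := frob_exp_gt0 v pcharOm; set q := (p ^ v)%N in hmu q_gt0 *.
move: f; apply: ideal_gen_ind => [|x y|c _ [h [hE ->]]].
- by rewrite cartier0; exact: ideal_gen0.
- by rewrite cartierD; exact: ideal_genD.
have [e eM ->] := prod_lin_exponents hE.
pose P := \prod_j lin a j ^+ (e j %/ q).
have key : cartier v pcharOm mu (P ^+ q * (c * \prod_j lin a j ^+ (e j %% q))) =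
    P * cartier v pcharOm mu (c * \prod_j lin a j ^+ (e j %% q)).
  move: (c * _) => {c}g; rewrite /P; move: g.
  elim/big_ind: _ => [g|x y IHx IHy g|j _ g].
  - by rewrite expr1n !mul1r.
  - by rewrite exprMn -!mulrA IHx IHy.
  elim: (e j %/ q)%N g => [|d IH] g; first by rewrite expr0 expr1n !mul1r.
  by rewrite exprS exprMn -!mulrA cartier_lin // IH.
have -> : c * \prod_j lin a j ^+ e j = P ^+ q * (c * \prod_j lin a j ^+ (e j %% q)).
  rewrite mulrCA; congr (_ * _); rewrite /P -prodrXl -big_split /=.
  by apply: eq_bigr => j _; rewrite -exprM -exprD -divn_eq.
rewrite key mulrC; apply: ideal_genM.
apply: (@filtration_le _ _ m (\sum_j e j %/ q)%N _ (ideal_pow_filtration (lins a))).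
  have : (\sum_(j < N.+1) (e j).+1 <= \sum_(j < N.+1) (e j %/ q).+1 * q)%N.
    by apply: leq_sum => j _; exact: ltn_ceil.
  rewrite -(eq_bigr _ (fun j _ => addn1 (e j))) big_split /= eM sum1_card card_ord.
  rewrite -big_distrl /= -(eq_bigr _ (fun j _ => addn1 _)) big_split /= sum1_card card_ord.
  move: (\sum_j _)%N => D le; rewrite -ltnS -(ltn_pmul2r q_gt0).
  by move: le; rewrite !mulnDl !mulSn; lia.
rewrite /P; elim/big_rec2: _ => [|j d x _ IH]; first exact: ideal_pow0.
by apply: ideal_powM => //; apply: ideal_powX; exists j.
Qed.

End CharpBound.

(** As [msize] is the degree plus one, this concerns polynomials of degree less than [d],
    inhomogeneous ones included. *)
Definition no_form (k : comNzRingType) (N s : nat) (a : 'I_s -> 'I_N.+1 -> k)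
    (m d : nat) : Prop :=
  forall f : {mpoly k[N.+1]}, (msize f <= d)%N -> (forall i, mult (a i) m f) -> f = 0.

Lemma msizeXn_le (k : idomainType) n (f : {mpoly k[n]}) u D :
  (msize f <= D.+1)%N -> (msize (f ^+ u) <= (u * D).+1)%N.
Proof.
have [->|nz] := eqVneq f 0.
  by move=> _; case: u => [|u]; rewrite ?expr0 ?msize1 // expr0n msize0.
have nzu : f ^+ u != 0 by rewrite expf_neq0.
rewrite -(mlead_deg nz) -(mlead_deg nzu) !ltnS mleadX // mdegMn mulnC => le.
by rewrite leq_mul2l le orbT.
Qed.

(** If the bound failed, some power [f^u] would have multiplicity at least [(m + N) q] and degree
    less than [q d], and a nonzero Cartier component of it would contradict [no_form]. *)
Lemma charp_degree_bound (Om : closedFieldType) (p N s : nat)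
    (a : 'I_s -> 'I_N.+1 -> Om) m d D M (f : {mpoly Om[N.+1]}) :
    p \in [pchar Om] -> (forall i, a i ord0 != 0) -> no_form a m d ->
    f != 0 -> (msize f <= D.+1)%N -> (forall i, mult (a i) M f) ->
  (M * d <= D * (m + N))%N.
Proof.
move=> pcharOm a0 nof nz lef mf; rewrite leqNgt; apply/negP => lt.
have M_gt0 : (0 < M)%N by case: (M) lt.
have p_gt1 : (1 < p)%N by rewrite prime_gt1 // (pcharf_prime pcharOm).
(* The choice [q > D M] absorbs the rounding in [u]: [u M D <= (m + N) D q + M D < ((m + N) D + 1) q
   <= M d q]. *)
pose v := (D * M)%N; pose q := (p ^ v)%N; pose u := ((m + N) * q %/ M).+1.
have ltq : (D * M < q)%N by exact: ltn_expl.
have geu : ((m + N) * q <= u * M)%N by apply: ltnW; exact: ltn_ceil.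
have leu : (u * M <= (m + N) * q + M)%N by rewrite mulSn addnC leq_add2r leq_trunc_div.
have ltuD : (u * D < q * d)%N.
  rewrite -(ltn_pmul2r M_gt0); apply: (@leq_ltn_trans (((m + N) * q + M) * D)).
    by rewrite mulnAC leq_mul2r leu orbT.
  apply: (@leq_trans ((D * (m + N)).+1 * q)); last by rewrite -mulnA [X in (_ <= X)%N]mulnC leq_mul2r [(d * M)%N]mulnC lt orbT.
  by rewrite mulSn mulnDl; move: ltq; nia.
have nzu : f ^+ u != 0 by rewrite expf_neq0.
have [mu [hmu]] := cartier_neq0 v pcharOm nzu; case/eqP; apply: nof.
  by apply: msize_cartier; apply: leq_trans (msizeXn_le u lef) ltuD.
move=> i; apply: mult_ideal_pow_lin; apply: cartier_ideal_pow => //.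
apply: (filtration_le (ideal_pow_filtration _) geu).
apply: (mult_in_filtration (ideal_pow_filtration _) _ (a0 i)) => [j|].
  by apply: ideal_pow1; exists j.
by rewrite [(u * M)%N]mulnC; exact: filtrationX (mult_filtration (a i)) (mf i).
Qed.

(** * Specialization to positive characteristic *)

(** [A] stands for its image, a subring of [K]: the kernel condition says that [phi] factors through
    it. The integer [c0] records the finitely many characteristics to avoid. *)
Definition specializable (K : fieldType) (A : comNzRingType)
    (iota : {rmorphism A -> K}) : Prop :=
  forall c, iota c != 0 -> exists2 c0 : int, c0 != 0 &
    forall Om : closedFieldType, (c0%:~R : Om) != 0 ->
    exists2 phi : {rmorphism A -> Om}, (forall z, iota z = 0 -> phi z = 0) & phi c != 0.

Lemma nat_minimal (P : nat -> Prop) : (exists n, P n) ->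
  exists2 n, P n & forall m, (m < n)%N -> ~ P m.
Proof.
move=> [n Pn]; apply: NNPP => abs.
suff : forall m, ~ P m by move/(_ n).
elim/ltn_ind => m IH Pm; apply: abs; exists m => // j ltjm; exact: IH.
Qed.

Section SpecializePoly.

Variables (K : fieldType) (A : comNzRingType) (iota : {rmorphism A -> K}) (u : K).

Lemma comm_iota : commr_rmorph iota u.
Proof. by move=> x; exact: mulrC. Qed.

Local Notation ev := (horner_morph comm_iota).
Local Notation ip := (map_poly iota).

Implicit Types (g h : {poly A}).

Lemma size_ip_le g : (size (ip g) <= size g)%N.
Proof. by rewrite map_polyE (leq_trans (size_Poly _)) // size_map. Qed.

(** Top coefficients of [g] may die in [K]; without them the leading coefficient is nonzero in [K],
    as pseudo-division requires. *)
Lemma truncate_poly g : exists2 g', ip g' = ip g & size g' = size (ip g).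
Proof.
have E : ip (take_poly (size (ip g)) g) = ip g.
  apply/polyP => i; rewrite !coef_map coef_take_poly /=.
  by case: ltnP => // le; rewrite rmorph0 -coef_map nth_default.
exists (take_poly (size (ip g)) g) => //; apply/eqP.
by rewrite eqn_leq size_take_poly /= -{1}E size_ip_le.
Qed.

Lemma ev_ip g g' : ip g = ip g' -> ev g = ev g'.
Proof. by rewrite /horner_morph => ->. Qed.

Lemma lead_ip g : size g = size (ip g) -> g != 0 -> iota (lead_coef g) != 0.
Proof.
move=> sz nz; rewrite lead_coefE -coef_map sz -lead_coefE lead_coef_eq0 /=.
by rewrite -size_poly_eq0 -sz size_poly_eq0.
Qed.

Lemma ev_rmod g h : exists e q,
  lead_coef h ^+ e *: g = q * h + Pdiv.CommonRing.rmodp g h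
  /\ iota (lead_coef h) ^+ e * ev g = ev q * ev h + ev (Pdiv.CommonRing.rmodp g h).
Proof.
exists (Pdiv.CommonRing.rscalp g h), (Pdiv.CommonRing.rdivp g h).
split; first exact: Pdiv.ComRing.rdivp_eq.
have := congr1 ev (Pdiv.ComRing.rdivp_eq h g).
by rewrite -mul_polyC rmorphM rmorphD rmorphM /= horner_morphC rmorphXn.
Qed.

Section Algebraic.

Variable h : {poly A}.
Hypotheses (evh : ev h = 0) (hsz : size h = size (ip h)) (hnz : h != 0).
Hypothesis hmin : forall g, ev g = 0 -> (size (ip g) < size h)%N -> ip g = 0.

(** The Euclidean algorithm on [c] and [h], by pseudo-division because [A] is not a field. [h] is a
    minimal polynomial of [u] with denominators cleared, and [c'] is the denominator of an inverse
    of [ev c]. *)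
Lemma ev_inverse c : ev c != 0 ->
  exists g c', ev g * ev c = iota c' /\ iota c' != 0.
Proof.
have [n] := ubnP (size (ip c)); elim: n c => // n IH c0 ltn0 evc0.
have [c cE csz] := truncate_poly c0; rewrite -(ev_ip cE) in evc0 *.
have cnz : c != 0 by apply: contraNneq evc0 => ->; rewrite rmorph0.
have lc : iota (lead_coef c) != 0 by apply: lead_ip => //; rewrite csz cE.
rewrite -csz in ltn0; have [le1|gt1] := leqP (size c) 1.
  have cC := size1_polyC le1; exists 1, c`_0; rewrite rmorph1 mul1r.
  by split; rewrite -(horner_morphC comm_iota) -cC.
have [le|lt] := leqP (size h) (size c).
  have [e [q [_ E]]] := ev_rmod c h; rewrite evh mulr0 add0r in E.
  have ltr : (size (Pdiv.CommonRing.rmodp c h) < size h)%N by rewrite Pdiv.CommonRing.ltn_rmodp.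
  have ltr' : (size (ip (Pdiv.CommonRing.rmodp c h)) < n)%N.
    exact: leq_ltn_trans (size_ip_le _) (leq_trans ltr (leq_trans le ltn0)).
  have evr : ev (Pdiv.CommonRing.rmodp c h) != 0.
    by rewrite -E mulf_neq0 // expf_neq0 // lead_ip.
  have [g [c' [gE c'nz]]] := IH _ ltr' evr.
  exists ((lead_coef h ^+ e)%:P * g), c'; split=> //.
  by rewrite rmorphM /= horner_morphC rmorphXn -gE -E; ring.
have [e [q [PE E]]] := ev_rmod h c; rewrite evh mulr0 in E.
have ltr : (size (Pdiv.CommonRing.rmodp h c) < size c)%N by rewrite Pdiv.CommonRing.ltn_rmodp.
set r := Pdiv.CommonRing.rmodp h c in PE E ltr.
have [evr|evr] := eqVneq (ev r) 0; last first.
  have ltr' : (size (ip r) < n)%N.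
    exact: leq_ltn_trans (size_ip_le _) (leq_trans ltr ltn0).
  have [g [c' [gE c'nz]]] := IH _ ltr' evr.
  exists (- (g * q)), c'; split=> //; rewrite rmorphN rmorphM -gE /=.
  by rewrite (_ : ev r = - (ev q * ev c)); [ring | apply/eqP; rewrite -addr_eq0 addrC -E].
(* A remainder that evaluates to zero would make [c] a proper factor of [h] over [K], with a
   cofactor vanishing at [u], against minimality. *)
have ipr : ip r = 0 by apply: hmin => //; apply: leq_ltn_trans (size_ip_le _) (ltn_trans ltr lt).
have evq : ev q = 0.
  by apply/eqP; move/eqP: E; rewrite evr addr0 eq_sym mulf_eq0 (negbTE evc0) orbF.
have {}PE : iota (lead_coef c) ^+ e *: ip h = ip q * ip c.
  by rewrite -rmorphXn -linearZ PE rmorphD rmorphM /= ipr addr0.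
have iph : ip h != 0 by rewrite -size_poly_eq0 -hsz size_poly_eq0.
have nzl : iota (lead_coef c) ^+ e != 0 by rewrite expf_neq0.
have nzq : ip q != 0.
  apply: contraNneq iph => q0; move/eqP: PE.
  by rewrite q0 mul0r scaler_eq0 (negbTE nzl).
have ipc : ip c != 0 by rewrite -size_poly_eq0 cE -csz size_poly_eq0.
have := congr1 (fun g : {poly K} => size g) PE.
rewrite size_scale // size_mul // cE -csz -hsz => sz.
case/eqP: nzq; apply: hmin => //; rewrite sz.
by case: (size c) gt1 => [|[|t]] // _; rewrite !addnS /= ltnS leq_addr.
Qed.

End Algebraic.

(** If [u] is transcendental, one nonzero coefficient of [c] is kept and [u] goes to a nonroot of
    the image of [c]. If [u] is algebraic, the leading coefficient of [h] and the denominator [c']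
    are kept and [u] goes to a root of the image of [h]; pseudo-division by [h] shows that the
    kernel dies. *)
Lemma specializable_poly : specializable iota ->
  specializable (horner_morph comm_iota).
Proof.
move=> spec c /= evc.
have comm (Om : closedFieldType) (phi : {rmorphism A -> Om}) y : commr_rmorph phi y.
  by move=> x; exact: mulrC.
have ip0 (Om : closedFieldType) (phi : {rmorphism A -> Om}) g :
    (forall z, iota z = 0 -> phi z = 0) -> ip g = 0 -> map_poly phi g = 0.
  move=> ker g0; apply/polyP => i; rewrite coef_map coef0 /= ker //.
  by rewrite -coef_map g0 coef0.
have [trans|/not_all_ex_not[h0 nh0]] := classic (forall g, ev g = 0 -> ip g = 0).
  have : ip c != 0 by apply: contraNneq evc => E; rewrite /horner_morph E horner0.
  rewrite -lead_coef_eq0 lead_coefE coef_map => /spec[c0 c0nz hc0].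
  exists c0 => // Om /hc0[phi ker nz].
  have /closed_nonrootP[y ny] : map_poly phi c != 0.
    by apply: contraNneq nz => E; rewrite -coef_map E coef0.
  exists (horner_morph (comm Om phi y)) => //= g /trans g0.
  by rewrite /horner_morph (ip0 _ _ _ ker g0) horner0.
have [n [h1 [evh1 [iph1 sz1]]] nmin] := @nat_minimal
  (fun n => exists h, ev h = 0 /\ ip h <> 0 /\ size (ip h) = n)
  (ex_intro _ _ (ex_intro _ h0 (match imply_to_and _ _ nh0 with conj a b => conj a (conj b erefl) end))).
have [h hE hsz] := truncate_poly h1.
have evh : ev h = 0 by rewrite (ev_ip hE).
have iph : ip h != 0 by rewrite hE; apply/eqP.
have hszh : size h = size (ip h) by rewrite hE.
have hnz : h != 0 by rewrite -size_poly_eq0 hszh size_poly_eq0.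
have hmin g : ev g = 0 -> (size (ip g) < size h)%N -> ip g = 0.
  move=> evg lt; apply: NNPP => nz; apply: (nmin (size (ip g))); last by exists g.
  by rewrite -sz1 -hsz.
have [g [c' [gE c'nz]]] := ev_inverse evh hszh hnz hmin evc.
have lh : iota (lead_coef h) != 0 by apply: lead_ip.
have : iota (lead_coef h * c') != 0 by rewrite rmorphM mulf_neq0.
move=> /spec[c0 c0nz hc0]; exists c0 => // Om /hc0[phi ker].
rewrite rmorphM mulf_eq0 negb_or => /andP[philh phic'].
have h_gt1 : (1 < size h)%N.
  rewrite ltnNge; apply: contraNN iph => /size1_polyC hC; move: evh.
  by rewrite hC horner_morphC map_polyC => /= ->; rewrite polyC0.
have szphi : size (map_poly phi h) = size h by rewrite size_map_poly_id0.
have /closed_rootP[y /eqP ry] : size (map_poly phi h) != 1 by rewrite szphi; lia.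
have kerphi x : ev x = 0 -> horner_morph (comm Om phi y) x = 0.
  move=> evx; have [e [q [PE E]]] := ev_rmod x h.
  have ipr : ip (Pdiv.CommonRing.rmodp x h) = 0.
    apply: hmin; last by apply: leq_ltn_trans (size_ip_le _) _; rewrite Pdiv.CommonRing.ltn_rmodp.
    by move: E; rewrite evx evh !mulr0 add0r.
  have := congr1 (horner_morph (comm Om phi y)) PE.
  have hh : horner_morph (comm Om phi y) h = 0 by [].
  have hr : horner_morph (comm Om phi y) (Pdiv.CommonRing.rmodp x h) = 0.
    by rewrite /horner_morph (ip0 _ _ _ ker ipr) horner0.
  rewrite -mul_polyC rmorphM rmorphD rmorphM /= horner_morphC hh hr mulr0 add0r.
  by move/eqP; rewrite mulf_eq0 rmorphXn expf_eq0 (negbTE philh) andbF => /eqP.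
exists (horner_morph (comm Om phi y)) => //.
have : horner_morph (comm Om phi y) (g * c - c'%:P) = 0.
  by apply: kerphi; rewrite rmorphB rmorphM /= horner_morphC gE subrr.
rewrite rmorphB rmorphM /= horner_morphC => /eqP; rewrite subr_eq0 => /eqP E.
by apply: contraNneq phic' => z; rewrite -E z mulr0.
Qed.

End SpecializePoly.

Lemma pchar0_intr_eq0 (K : fieldType) (z : int) : [pchar K] =i pred0 ->
  (z%:~R : K) = 0 -> z = 0.
Proof.
move=> /pcharf0P char0; case: z => n; first by move=> /eqP; rewrite -pmulrn char0 => /eqP ->.
by rewrite NegzE mulrNz => /eqP; rewrite oppr_eq0 -pmulrn char0.
Qed.

Lemma specializable_int (K : fieldType) : [pchar K] =i pred0 ->
  specializable (intmul (1 : K)).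
Proof.
move=> char0 c cnz; exists c; first by apply: contraNneq cnz => ->.
move=> Om cOm; exists (intmul (1 : Om)) => // z.
by move=> /(pchar0_intr_eq0 char0) ->.
Qed.

Lemma specialization (K : fieldType) (n : nat) (x : 'I_n -> K) : [pchar K] =i pred0 ->
  exists (A : comNzRingType) (iota : {rmorphism A -> K}) (z : 'I_n -> A),
    (forall i, iota (z i) = x i) /\ specializable iota.
Proof.
move=> char0; elim: n x => [|n IH] x.
  by exists int, (intmul (1 : K)), (fun _ => 0); split=> [[]|] //; exact: specializable_int.
have [A [iota [z [zE spec]]]] := IH (fun i => x (lift ord0 i)).
exists {poly A}, (horner_morph (comm_iota iota (x ord0))).
exists (fun i => if unlift ord0 i is Some j then (z j)%:P else 'X); split.
  move=> i; case: unliftP => [j|] ->; first by rewrite /= horner_morphC zE.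
  by rewrite /= horner_morphX.
exact: specializable_poly.
Qed.

Lemma closed_field_pchar (c0 : int) : c0 != 0 ->
  exists (p : nat) (Om : closedFieldType), p \in [pchar Om] /\ (c0%:~R : Om) != 0.
Proof.
move=> nz; pose p := pdiv (`|c0|%N`!.+1).
have pp : prime p by rewrite pdiv_prime // ltnS fact_gt0.
have ltp : (`|c0| < p)%N.
  rewrite ltnNge; apply/negP => le; have := pdiv_dvd (`|c0|%N`!.+1); rewrite -/p -addn1.
  by rewrite dvdn_addr ?dvdn1 ?dvdn_fact ?prime_gt0 // => /eqP E; rewrite E in pp.
have [L [phi _]] := countable_algebraic_closure 'F_p.
exists p, L; have pL : p \in [pchar L] by apply: (rmorph_pchar phi); exact: pchar_Fp.
split=> //; rewrite -absz_eq0 in nz.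
have E : (`|c0|%N%:R : L) != 0.
  rewrite -(dvdn_pcharf pL); apply/negP => /dvdn_leq; rewrite lt0n nz => /(_ isT).
  by rewrite leqNgt ltp.
by move: E; case: (c0) => n //=; rewrite NegzE mulrNz oppr_eq0.
Qed.

(** * Degree bound in characteristic zero and genericity *)

Lemma tay_eq (A : comNzRingType) (N : nat) (a b : 'I_N.+1 -> A) f :
  a =1 b -> tay a f = tay b f.
Proof.
move=> ab; rewrite [f]mpolyE !rmorph_sum /=; apply: eq_bigr => mu _.
rewrite !tayZ !tayX; congr (_ * _); apply: eq_bigr => j _.
by rewrite tay_var.unlock !linE !ab.
Qed.

(** * Multiplicity conditions as a matrix *)

Section ConditionMatrix.

Variables (N s m d : nat).

Definition cond_row (u : 'I_#|{: 'X_{1..N.+1 < d}}|) : 'X_{1..N.+1} :=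
  bmnm (enum_val u : 'X_{1..N.+1 < d}).

Definition cond_col (w : 'I_#|{: 'I_s * 'I_m * 'X_{1..N.+1 < d}}|) :
  'I_s * 'I_m * 'X_{1..N.+1 < d} := enum_val w.

(** Rows are monomials of degree less than [d]; columns are the coefficients of the Taylor terms of
    order less than [m] at each point. The left kernel consists of the polynomials that [no_form]
    excludes, and the entries are natural in the coordinates. *)
Definition cond_mx (A : comNzRingType) (x : 'I_s -> 'I_N.+1 -> A) :
    'M[A]_(#|{: 'X_{1..N.+1 < d}}|, #|{: 'I_s * 'I_m * 'X_{1..N.+1 < d}}|) :=
  \matrix_(u, w) ((tay (x (cond_col w).1.1) 'X_[cond_row u])`_((cond_col w).1.2))
                   @_(bmnm (cond_col w).2).

Lemma cond_mx_map (A B : comNzRingType) (phi : {rmorphism A -> B})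
    (x : 'I_s -> 'I_N.+1 -> A) :
  map_mx phi (cond_mx x) = cond_mx (fun i j => phi (x i j)).
Proof.
apply/matrixP => u w; rewrite !mxE.
set i := (cond_col w).1.1; set mu := cond_row u.
have -> : tay (fun j => phi (x i j)) 'X_[mu] = map_poly (map_mpoly phi) (tay (x i) 'X_[mu]).
  by rewrite -tay_map map_mpolyX.
by rewrite coef_map mcoeff_map_mpoly.
Qed.

Variable k : fieldType.
Implicit Type a : 'I_s -> 'I_N.+1 -> k.

(** Hence columns indexed by monomials of degree less than [d] record every condition. *)
Lemma tay_mcoeff0 (b : 'I_N.+1 -> k) (f : {mpoly k[N.+1]}) i nu : (msize f <= d)%N ->
  (d <= mdeg nu)%N -> ((tay b f)`_i)@_nu = 0.
Proof.
move=> lef led; rewrite [f]mpolyE rmorph_sum /= coef_sum raddf_sum /= big_seq big1 // => mu hmu.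
rewrite tayZ coefCM mcoeffCM; have hX : ('X_[mu] : {mpoly k[N.+1]}) \is (mdeg mu).-homog by rewrite dhomogX.
rewrite (dhomog_nemf_coeff (homogp_tay b hX i)) ?mulr0 //=.
by rewrite gtn_eqF // (leq_trans (leq_trans (msize_mdeg_lt hmu) lef)).
Qed.

Lemma mul_cond_mx a (v : 'rV[k]_(#|{: 'X_{1..N.+1 < d}}|)) w :
  (v *m cond_mx a) 0 w =
  ((tay (a (cond_col w).1.1) (\sum_u v 0 u *: 'X_[cond_row u]))`_((cond_col w).1.2))
    @_(bmnm (cond_col w).2).
Proof.
rewrite mxE rmorph_sum /= coef_sum raddf_sum /=; apply: eq_bigr => u _.
by rewrite tayZ coefCM mcoeffCM mxE.
Qed.

Lemma no_formP a : no_form a m d <-> row_free (cond_mx a).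
Proof.
split=> [nof|rf f lef mf].
  apply: inj_row_free => v v0.
  pose f := \sum_u v 0 u *: 'X_[cond_row u] : {mpoly k[N.+1]}.
  have lef : (msize f <= d)%N.
    rewrite /f; elim/big_ind: _ => [|x y lex ley|u _]; first by rewrite msize0.
      by rewrite (leq_trans (mmeasureD_le _ _ _)) // geq_max lex.
    by rewrite (leq_trans (msizeZ_le _ _)) // msizeX bmdeg.
  have f0 : f = 0.
    apply: nof => // i t ltt; apply/mpolyP => nu; rewrite mcoeff0.
    have [ltnu|] := ltnP (mdeg nu) d; last exact: tay_mcoeff0.
    pose w := enum_rank (i, Ordinal ltt, BMultinom ltnu).
    have := mul_cond_mx a v w; rewrite v0 mxE /cond_col {}/w enum_rankK /= => <-.
    by [].
  apply/rowP => u; rewrite mxE; have := congr1 (mcoeff (cond_row u)) f0.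
  rewrite mcoeff0 raddf_sum /= (bigD1 u) //= big1 => [|u' neq].
    by rewrite addr0 mcoeffZ mcoeffX eqxx mulr1.
  rewrite mcoeffZ mcoeffX; case: eqP => [E|_]; last by rewrite mulr0.
  by case/eqP: neq; apply: enum_val_inj; apply: val_inj.
pose v : 'rV[k]_(#|{: 'X_{1..N.+1 < d}}|) := \row_u f@_(cond_row u).
have fE : f = \sum_u v 0 u *: 'X_[cond_row u].
  rewrite {1}(mpolywE lef) (reindex (@enum_val _ (mem {: 'X_{1..N.+1 < d}}))) /=.
    by apply: eq_bigr => u _; rewrite mxE.
  by apply: onW_bij; exact: enum_val_bij.
have : v *m cond_mx a = 0.
  by apply/rowP => w; rewrite mul_cond_mx -fE mf // mcoeff0 mxE.
move=> /eqP; rewrite mulmx_free_eq0 // => /eqP v0.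
by rewrite fE big1 // => u _; rewrite v0 mxE scale0r.
Qed.

End ConditionMatrix.

Lemma row_free_minorP (k : fieldType) p q (M : 'M[k]_(p, q)) :
  row_free M <-> exists g : 'I_p -> 'I_q, \det (colsub g M) != 0.
Proof.
split=> [rf|[g dg]].
  have full : row_full M^T by rewrite /row_full mxrank_tr.
  exists (fullrankfun full); rewrite -unitfE -unitmxE -unitmx_tr.
  suff -> : (colsub (fullrankfun full) M)^T = rowsub (fullrankfun full) M^T by exact: fullrowsub_unit.
  by apply/matrixP => i j; rewrite !mxE.
apply: inj_row_free => v v0.
have : v *m colsub g M = 0 by rewrite mulmx_colsub v0; apply/matrixP => i j; rewrite !mxE.
move=> /eqP; rewrite mulmx_free_eq0 ?row_free_unit ?unitmxE ?unitfE // => /eqP.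
by [].
Qed.

Lemma det_colsub_map (A B : comNzRingType) (phi : {rmorphism A -> B}) p q
    (M : 'M[A]_(p, q)) (g : 'I_p -> 'I_q) :
  \det (colsub g (map_mx phi M)) = phi (\det (colsub g M)).
Proof. by rewrite -det_map_mx map_mxsub. Qed.

(** [phi] can be chosen to keep one given minor nonzero, which transports [no_form]; it kills the
    kernel of [iota], hence every minor that vanishes over [k], which transports the existence of
    [f]. *)
Theorem pchar0_degree_bound (k : fieldType) (N s : nat)
    (a : 'I_s -> 'I_N.+1 -> k) m d D M (f : {mpoly k[N.+1]}) :
    [pchar k] =i pred0 -> (forall i, a i ord0 != 0) -> no_form a m d ->
    f != 0 -> (msize f <= D.+1)%N -> (forall i, mult (a i) M f) ->
  (M * d <= D * (m + N))%N.
Proof.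
move=> char0 a0 /no_formP/row_free_minorP[g dg] fnz lef mf.
have [A [iota [z0 [z0E spec]]]] := specialization
  (fun t : 'I_#|{: 'I_s * 'I_N.+1}| => a (enum_val t).1 (enum_val t).2) char0.
pose z i j := z0 (enum_rank (i, j)).
have zE i j : iota (z i j) = a i j by rewrite z0E enum_rankK.
have aE m' d' : cond_mx m' d' a = map_mx iota (cond_mx m' d' z).
  rewrite cond_mx_map; apply/matrixP => u w; rewrite !mxE.
  have E i h : tay (a i) h = tay (fun j => iota (z i j)) h.
    by apply: tay_eq => j; rewrite zE.
  by rewrite E.
(* A single element carries all that must survive: the minor and the coordinates x_0 of the
   points. *)
have [] := spec (\det (colsub g (cond_mx m d z)) * \prod_i z i ord0).
  rewrite rmorphM rmorph_prod mulf_neq0 //; first by rewrite -det_colsub_map -aE.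
  by apply/prodf_neq0 => i _; rewrite zE.
move=> c0 c0nz hc0; have [p [Om [pOm c0Om]]] := closed_field_pchar c0nz.
have [phi ker] := hc0 Om c0Om; rewrite rmorphM mulf_eq0 negb_or => /andP[dphi zphi].
have b0 i : phi (z i ord0) != 0.
  by move: zphi; rewrite rmorph_prod => /prodf_neq0 /(_ i isT).
have nob : no_form (fun i j => phi (z i j)) m d.
  apply/no_formP/row_free_minorP; exists g.
  by rewrite -cond_mx_map det_colsub_map.
have : ~ no_form (fun i j => phi (z i j)) M D.+1.
  move=> /no_formP/row_free_minorP[g']; rewrite -cond_mx_map det_colsub_map => dg'.
  suff /no_formP nof : row_free (cond_mx M D.+1 a) by case/eqP: fnz; exact: nof.
  apply/row_free_minorP; exists g'; rewrite aE det_colsub_map.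
  by apply: contraNneq dg' => /ker ->.
case/not_all_ex_not=> f' nf; have [lef' nf'] := imply_to_and _ _ nf.
have [mf' /eqP fnz'] := imply_to_and _ _ nf'.
exact: charp_degree_bound pOm b0 nob fnz' lef' mf'.
Qed.

(** * Properties of general points *)

Definition gen_open (k : fieldType) (n : nat) (P : ('I_n -> k) -> Prop) : Prop :=
  exists p : {mpoly k[n]}, (exists v, p.@[v] != 0) /\ forall v, p.@[v] != 0 -> P v.

Lemma pchar0_natr_inj (k : fieldType) : [pchar k] =i pred0 ->
  injective (fun n : nat => n%:R : k).
Proof.
move=> char0 m n /= E; have : ((m%:Z - n%:Z)%:~R : k) = 0.
  by rewrite rmorphB /= -!pmulrn E subrr.
by move=> /(pchar0_intr_eq0 char0) /eqP; rewrite subr_eq0 => /eqP[].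
Qed.

Lemma pchar0_nonroot (k : fieldType) (p : {poly k}) : [pchar k] =i pred0 ->
  p != 0 -> exists x, p.[x] != 0.
Proof.
move=> char0 nz; apply: NNPP => abs.
have := @max_poly_roots _ p [seq i%:R | i <- iota 0 (size p)] nz.
rewrite size_map size_iota ltnn => h; suff : false by []; apply: h.
  by apply/allP => x _; apply/negPn/negP => nr; apply: abs; exists x.
by rewrite map_inj_uniq ?iota_uniq //; exact: pchar0_natr_inj.
Qed.

(* Two nonempty principal open sets meet on the line through a point of each. *)
Lemma gen_openI (k : fieldType) (n : nat) (P Q : ('I_n -> k) -> Prop) :
  [pchar k] =i pred0 -> gen_open P -> gen_open Q -> gen_open (fun v => P v /\ Q v).
Proof.
move=> char0 [p [[v pv] hp]] [q [[w qw] hq]]; exists (p * q).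
split; last by move=> x; rewrite mevalM mulf_eq0 negb_or => /andP[/hp ? /hq].
pose c j : {poly k} := (v j)%:P + 'X * (w j - v j)%:P.
have cE (f : {mpoly k[n]}) t : (mmap polyC c f).[t] = f.@[fun j => v j + t * (w j - v j)].
  rewrite [f]mpolyE !rmorph_sum /= horner_sum; apply: eq_bigr => mu _.
  rewrite mmapZ hornerM hornerC mmapX /mmap1 horner_prod mevalZ mevalX; congr (_ * _).
  by apply: eq_bigr => j _; rewrite horner_exp /c hornerD hornerM hornerX !hornerC.
have nzp : mmap polyC c p != 0.
  apply: contraNneq pv => E; rewrite -(@meval_eq _ _ (fun j => v j + 0 * (w j - v j))).
    by rewrite -cE E horner0.
  by move=> j; rewrite mul0r addr0.
have nzq : mmap polyC c q != 0.
  apply: contraNneq qw => E; rewrite -(@meval_eq _ _ (fun j => v j + 1 * (w j - v j))).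
    by rewrite -cE E horner0.
  by move=> j; rewrite mul1r addrC subrK.
have [t] := pchar0_nonroot char0 (mulf_neq0 nzp nzq).
by rewrite hornerM !cE -mevalM => nz; exists (fun j => v j + t * (w j - v j)).
Qed.

Section GenericPoints.

Variables (k : fieldType) (N s : nat).

Definition coord_points (v : 'I_(s * N.+1) -> k) (i : 'I_s) (j : 'I_N.+1) : k :=
  v (mxvec_index i j).

Definition var_points (i : 'I_s) (j : 'I_N.+1) : {mpoly k[s * N.+1]} :=
  'X_(mxvec_index i j).

Lemma coord_pointsK (a : 'I_s -> 'I_N.+1 -> k) i :
  coord_points (param_coords (\matrix_(i, j) a i j)) i =1 a i.
Proof. by move=> j; rewrite /coord_points /param_coords mxvecE mxE. Qed.

(** By naturality a minor at indeterminate coordinates is a polynomial whose values are the minors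
    at actual points; one good configuration shows that it has a nonzero value. *)
Lemma gen_open_row_free p q
    (M : forall A : comNzRingType, ('I_s -> 'I_N.+1 -> A) -> 'M[A]_(p, q)) :
    (forall (A B : comNzRingType) (phi : {rmorphism A -> B}) x,
       map_mx phi (M A x) = M B (fun i j => phi (x i j))) ->
    (forall A x y, (forall i, x i =1 y i) -> M A x = M A y) ->
    (exists a, row_free (M k a)) ->
  gen_open (fun v => row_free (M k (coord_points v))).
Proof.
move=> Mmap Meq [a /row_free_minorP[g dg]].
have detE v : (\det (colsub g (M _ var_points))).@[v] =
    \det (colsub g (M _ (coord_points v))).
  rewrite -[LHS]/(meval v _) -det_colsub_map Mmap; congr (\det (colsub _ _)).
  by apply: Meq => i j; exact: mevalXU.
exists (\det (colsub g (M _ var_points))); split.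
  exists (param_coords (\matrix_(i, j) a i j)); rewrite detE.
  by rewrite (Meq _ _ a) //; exact: coord_pointsK.
by move=> v; rewrite detE => dv; apply/row_free_minorP; exists g.
Qed.

Lemma gen_open_no_form m d :
  (exists a : 'I_s -> 'I_N.+1 -> k, no_form a m d) ->
  gen_open (fun v => no_form (coord_points v) m d).
Proof.
move=> [a nof].
have [|||p [nzp hp]] := @gen_open_row_free _ _ (@cond_mx N s m d).
- by move=> *; exact: cond_mx_map.
- by move=> A x y xy; apply/matrixP => u w; rewrite !mxE (tay_eq _ (xy _)).
- by exists a; apply/no_formP.
by exists p; split=> // v /hp /no_formP.
Qed.

Lemma gen_open_nonzero0 : gen_open (fun v => forall i, coord_points v i ord0 != 0).
Proof.
exists (\prod_i var_points i ord0); split=> [|v].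
  exists (fun _ => 1); rewrite rmorph_prod; apply/prodf_neq0 => i _.
  by rewrite /= mevalXU oner_eq0.
rewrite rmorph_prod => /prodf_neq0 h i; have := h i isT.
by rewrite /= mevalXU.
Qed.

End GenericPoints.

(** * Separators of general points *)

Section EvalMatrix.

Variables (N s rho : nat).

(** Exponent vectors of degree [rho], kept as tuples so that [card_ord_partitions] counts them. *)
Definition hmons : {set N.+1.-tuple 'I_rho.+1} := 
  [set t : N.+1.-tuple 'I_rho.+1 | \sum_(i <- t) i == rho]%N.

Definition hmon (u : 'I_#|hmons|) : N.+1.-tuple 'I_rho.+1 := enum_val u.

Lemma hmon_deg u : (\sum_(j < N.+1) tnth (hmon u) j)%N = rho.
Proof.
have := enum_valP u; rewrite inE -[enum_val u]/(hmon u) => /eqP E.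
by rewrite -[RHS]E big_tuple.
Qed.

Definition eval_mx (A : comNzRingType) (x : 'I_s -> 'I_N.+1 -> A) : 'M[A]_(s, #|hmons|) :=
  \matrix_(i, u) \prod_(j < N.+1) x i j ^+ tnth (hmon u) j.

Variable k : fieldType.

Lemma eval_mx_separators (a : 'I_s -> 'I_N.+1 -> k) : row_free (eval_mx a) ->
  exists F : 'I_s -> {mpoly k[N.+1]}, (forall i, F i \is rho.-homog)
    /\ forall i j, (F i).@[a j] = (i == j)%:R.
Proof.
move=> /row_freeP[B BE].
pose mu u : 'X_{1..N.+1} := [multinom (tnth (hmon u) j : nat) | j < N.+1].
exists (fun i => \sum_u B u i *: 'X_[mu u]); split=> [i|i j].
  apply: rpred_sum => u _; apply: dhomogZ; rewrite dhomogX /= mdegE.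
  by apply/eqP; rewrite -[RHS](hmon_deg u); apply: eq_bigr => j _; rewrite mnmE.
have := congr1 (fun M : 'M_s => M j i) BE; rewrite !mxE eq_sym => <-.
rewrite (raddf_sum (meval (a j))) /=; apply: eq_bigr => u _.
rewrite mevalZ mevalX mulrC mxE; congr (_ * _).
by apply: eq_bigr => l _; rewrite mnmE.
Qed.

Lemma digits_inj (B n : nat) (t t' : 'I_n -> nat) : (forall j, t j < B)%N ->
  (forall j, t' j < B)%N -> (\sum_(j < n) t j * B ^ j = \sum_(j < n) t' j * B ^ j)%N ->
  t =1 t'.
Proof.
elim: n t t' => [|n IH] t t' ht ht' E [j ltj] //.
move: E; rewrite !big_ord_recl /= !expn0 !muln1.
have sumE (f : 'I_n.+1 -> nat) : (\sum_(i < n) f (lift ord0 i) * B ^ bump 0 i =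
    (\sum_(i < n) f (lift ord0 i) * B ^ i) * B)%N.
  by rewrite big_distrl; apply: eq_bigr => i _ /=; rewrite /bump add1n expnS; lia.
rewrite !sumE => E; have B_gt0 : (0 < B)%N by apply: leq_ltn_trans (ht ord0).
have E0 : t ord0 = t' ord0.
  have := congr1 (modn^~ B) E; rewrite /= ![(_ + _ * B)%N]addnC !modnMDl.
  by rewrite !modn_small.
move: E; rewrite E0 => /addnI /eqP; rewrite eqn_pmul2r // => /eqP E.
have [j0|] := unliftP ord0 (Ordinal ltj).
  by move=> ->; apply: (IH (fun i => t (lift ord0 i)) (fun i => t' (lift ord0 i))).
by move=> ->.
Qed.

(* On the monomial curve, evaluation at the i-th point sends the monomial [u] to the
   i-th power of [2 ^ code u]: the matrix is a Vandermonde matrix. *)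
Lemma eval_mx_free : [pchar k] =i pred0 -> (s <= 'C(N + rho, N))%N ->
  exists a : 'I_s -> 'I_N.+1 -> k, row_free (eval_mx a).
Proof.
(* Exponents are below [rho + 1], so [code] reads them as digits in that base and is injective. *)
move=> char0 les; pose code (u : 'I_#|hmons|) := (\sum_(j < N.+1) tnth (hmon u) j * rho.+1 ^ j)%N.
exists (fun i j => ((2 ^ (rho.+1 ^ j)) ^ i)%N%:R); apply: inj_row_free => v v0.
(* A vector in the left kernel gives a polynomial of degree less than [s] with at least [s] roots;
   the default 0 is never reached. *)
pose P := \poly_(i < s) (if insub i is Some i' then v 0 i' else 0).
have rootP u : root P (2 ^ code u)%:R.
  have := congr1 (fun M : 'rV_#|hmons| => M 0 u) v0; rewrite !mxE => E.
  rewrite rootE horner_poly -[X in _ == X]E; apply/eqP.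
  apply: eq_bigr => i _; rewrite mxE valK; congr (_ * _).
  rewrite -natrX -expnM; transitivity ((\prod_(j < N.+1) ((2 ^ rho.+1 ^ j) ^ i) ^ tnth (hmon u) j)%N%:R : k).
    congr (_%:R); rewrite /code big_distrl /= (big_morph _ (expnD 2) (expn0 2)).
    apply: eq_bigr => j _; rewrite -!expnM.
    have mE x y z : (x * y * z = y * z * x)%N by rewrite -mulnA mulnC.
    by rewrite mE mulnA.
  by rewrite natr_prod; apply: eq_bigr => j _; rewrite natrX.
have P0 : P = 0.
  apply: (@roots_geq_poly_eq0 _ _ [seq (2 ^ code u)%:R | u <- enum 'I_#|hmons|]).
  - by apply/allP => _ /mapP[u _ ->].
  - rewrite map_inj_uniq ?enum_uniq // => u u' /(pchar0_natr_inj char0) /eqP.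
    rewrite eqn_exp2l // => /eqP E; apply: enum_val_inj; apply: eq_from_tnth => j.
    by apply: val_inj; apply: (@digits_inj rho.+1 _ (fun j => tnth (hmon u) j) (fun j => tnth (hmon u') j)).
  - rewrite size_map size_enum_ord (leq_trans (size_poly _ _)) //.
    by rewrite card_ord_partitions.
apply/rowP => i; have := congr1 (fun Q : {poly k} => Q`_i) P0.
by rewrite coef_poly ltn_ord valK coef0 mxE.
Qed.

Lemma gen_open_separators : [pchar k] =i pred0 -> (s <= 'C(N + rho, N))%N ->
  gen_open (fun v : 'I_(s * N.+1) -> k => exists F : 'I_s -> {mpoly k[N.+1]},
    (forall i, F i \is rho.-homog) /\
    forall i j, (F i).@[coord_points v j] = (i == j)%:R).
Proof.
move=> char0 les.
have [|||p [nzp hp]] := @gen_open_row_free k N s _ _ eval_mx.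
- move=> A B phi x; apply/matrixP => i u; rewrite !mxE rmorph_prod.
  by apply: eq_bigr => j _; rewrite rmorphXn.
- by move=> A x y xy; apply/matrixP => i u; rewrite !mxE; apply: eq_bigr => j _; rewrite xy.
- exact: eval_mx_free.
by exists p; split=> // v /hp /eval_mx_separators.
Qed.

End EvalMatrix.

(** * Special configurations *)

Lemma mpoly_ring_ind (k : comNzRingType) n (P : {mpoly k[n]} -> Prop) :
    (forall c, P c%:MP) -> (forall i, P 'X_i) ->
    (forall f g, P f -> P g -> P (f + g)) -> (forall f g, P f -> P g -> P (f * g)) ->
  forall f, P f.
Proof.
move=> PC PX PD PM f; rewrite [f]mpolyE.
elim/big_ind: _ => [| |mu _]; [by rewrite -mpolyC0; exact: PC | exact: PD |].
rewrite -mul_mpolyC; apply: (PM) => //; rewrite mpolyXE_id.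
elim/big_ind: _ => [| |i _]; [by rewrite -mpolyC1; exact: PC | exact: PM |].
by elim: (mu i) => [|e IH]; rewrite ?expr0 -?mpolyC1 // exprS; exact: PM.
Qed.

Lemma mpoly_rmorph_ext (k : comNzRingType) n (S : nzRingType)
    (F G : {rmorphism {mpoly k[n]} -> S}) :
  (forall c, F c%:MP = G c%:MP) -> (forall i, F 'X_i = G 'X_i) -> F =1 G.
Proof.
move=> FC FX; apply: mpoly_ring_ind => // f g Ff Fg.
  by rewrite !rmorphD Ff Fg.
by rewrite !rmorphM Ff Fg.
Qed.

Section Substitution.

Variables (k : idomainType) (n : nat).
Implicit Types (h : 'I_n -> {mpoly k[n]}) (f : {mpoly k[n]}).

Definition msubst h f : {mpoly k[n]} := mmap (@mpolyC n k) h f.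

HB.instance Definition _ h := GRing.RMorphism.copy (msubst h) (mmap (@mpolyC n k) h).

Lemma msubstC h c : msubst h c%:MP = c%:MP.
Proof. exact: mmapC. Qed.

Lemma msubstX h i : msubst h 'X_i = h i.
Proof. by rewrite /msubst mmapX mmap1U. Qed.

Lemma msizeM_leS d e f g : (msize f <= d.+1)%N -> (msize g <= e.+1)%N ->
  (msize (f * g) <= (d + e).+1)%N.
Proof.
have [->|nzf] := eqVneq f 0; first by rewrite mul0r msize0.
have [->|nzg] := eqVneq g 0; first by rewrite mulr0 msize0.
by rewrite msizeM //; lia.
Qed.

Lemma msize_msubst h f : (forall i, (msize (h i) <= 2)%N) -> (msize (msubst h f) <= msize f)%N.
Proof.
move=> hh; rewrite {1}[f]mpolyE rmorph_sum /= big_seq.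
elim/big_ind: _ => [|x y lex ley|mu hmu]; first by rewrite msize0.
  by rewrite (leq_trans (mmeasureD_le _ _ _)) // geq_max lex.
rewrite /msubst mmapZ mul_mpolyC (leq_trans (msizeZ_le _ _)) //.
apply: leq_trans (msize_mdeg_lt hmu); rewrite mmapX /mmap1 mdegE.
elim/big_rec2: _ => [|i d x _ IH]; first by rewrite msize1.
apply: msizeM_leS => //; elim: (mu i) => [|e IHe]; first by rewrite expr0 msize1.
by rewrite exprS; apply: (@msizeM_leS 1 e).
Qed.

End Substitution.

(** * Grids of points *)

Section Grid.

Variables (k : fieldType) (N t : nat).
Hypothesis char0 : [pchar k] =i pred0.
Local Notation mpo := {mpoly k[N.+1]}.
Implicit Types (g : 'I_N.+1 -> nat) (f : mpo).

Definition grid_pt g (j : 'I_N.+1) : k := if j == ord0 then 1 else (g j)%:R.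

Definition first_vars (J : nat) (i : 'I_N.+1) : mpo := if (i <= J)%N then 'X_i else 0.

Definition layer (j : 'I_N.+1) (v : nat) (i : 'I_N.+1) : mpo :=
  if i == j then v%:R *: 'X_ord0 else 'X_i.

Definition layer_form (j : 'I_N.+1) (v : nat) : mpo := 'X_j - v%:R *: 'X_ord0.

Lemma tay_X0 (a : 'I_N.+1 -> k) : a ord0 = 1 -> tay a 'X_ord0 = ('X_ord0)%:P.
Proof.
by move=> a0; rewrite tayXU tay_var.unlock linE a0 subrr polyC0 mulr0 addr0 scale1r.
Qed.

Lemma layer_division j v f : exists q, f - msubst (layer j v) f = layer_form j v * q.
Proof.
move: f; apply: mpoly_ring_ind => [c|i|x y [p pE] [q qE]|x y [p pE] [q qE]].
- by exists 0; rewrite msubstC subrr mulr0.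
- rewrite msubstX /layer; have [->|_] := eqVneq i j; first by exists 1; rewrite mulr1.
  by exists 0; rewrite subrr mulr0.
- by exists (p + q); rewrite rmorphD mulrDr -pE -qE opprD addrACA.
exists (x * q + p * msubst (layer j v) y); rewrite rmorphM mulrDr mulrCA -qE mulrA -pE /=.
by rewrite mulrBr mulrBl addrA subrK.
Qed.

(** The substitution intertwines the Taylor expansions at the two points, so orders cannot drop;
    both composites are ring morphisms, compared on variables. *)
Lemma mult_layer g j v m f : j != ord0 -> g j = v -> mult (grid_pt g) m f ->
  mult (grid_pt (fun i => if i == j then 0%N else g i)) m (msubst (layer j v) f).
Proof.
move=> j0 gj mf; set g' := fun i => _.
suff E : tay (grid_pt g') (msubst (layer j v) f) =
    map_poly (msubst (layer j v)) (tay (grid_pt g) f).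
  by move=> i lti; rewrite E coef_map /= mf ?rmorph0.
have X0E : msubst (layer j v) 'X_ord0 = 'X_ord0.
  by rewrite msubstX /layer eq_sym (negbTE j0).
have subZ c x : msubst (layer j v) (c *: x) = c *: msubst (layer j v) x.
  by rewrite -!mul_mpolyC rmorphM /= msubstC.
move: f {mf}; apply: (@mpoly_rmorph_ext _ _ _ (tay (grid_pt g') \o msubst (layer j v))
  (map_poly (msubst (layer j v)) \o tay (grid_pt g))) => [c|i] /=.
  by rewrite msubstC !tayE !mmapC /= map_polyC /= msubstC.
rewrite [tay (grid_pt g) _]tayXU [in RHS]tay_var.unlock linE.
rewrite [RHS]rmorphD [X in _ = _ + X]rmorphM /= map_polyX !map_polyC /= [msubst _ (_ - _)]rmorphB /=.
rewrite !subZ X0E msubstX /layer /grid_pt; have [->|neq] := eqVneq i j.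
  rewrite (negbTE j0) eqxx gj scale1r subrr polyC0 mulr0 addr0 tayZ tay_X0 //.
  by rewrite -polyCM mul_mpolyC.
rewrite tayXU tay_var.unlock linE /grid_pt /g' (negbTE neq).
by rewrite eqxx.
Qed.

Lemma tay_layer_form g j v : j != ord0 -> g j = v ->
  tay (grid_pt g) (layer_form j v) = 'X * (layer_form j v)%:P.
Proof.
move=> j0 gj; rewrite /layer_form rmorphB /= tayZ tay_X0 // tayXU tay_var.unlock linE.
rewrite /grid_pt (negbTE j0) eqxx gj scale1r -polyCM mul_mpolyC addrAC subrr add0r.
by [].
Qed.

Lemma layer_form_neq0 j v : j != ord0 -> layer_form j v != 0.
Proof.
move=> j0; apply/eqP => /(congr1 (meval (fun i => (i == j)%:R))).
rewrite meval0 mevalB mevalZ !mevalXU eqxx eq_sym (negbTE j0) mulr0 subr0.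
by move/eqP; rewrite oner_eq0.
Qed.

Lemma layer_form_homog j v : layer_form j v \is 1.-homog.
Proof. by apply: rpredB; rewrite ?rpredZ // dhomogX /= mdeg1. Qed.

Lemma msize_layer_form j v f : j != ord0 -> f != 0 ->
  msize (layer_form j v * f) = (msize f).+1.
Proof.
move=> j0 nz; rewrite msizeM ?layer_form_neq0 //.
suff -> : msize (layer_form j v) = 2 by [].
have nzl := layer_form_neq0 v j0; rewrite -(mlead_deg nzl).
by have /dhomogP /(_ _ (mlead_supp nzl)) /= -> := layer_form_homog j v.
Qed.

(* [f] involves only the variables x_0, ..., x_J. *)
Definition depends_on (J : nat) f : Prop := msubst (first_vars J) f = f.

Lemma mult_layer_factor g j v m f : j != ord0 -> g j = v ->
  mult (grid_pt g) m (layer_form j v * f) -> mult (grid_pt g) m.-1 f.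
Proof.
move=> j0 gj mf i lti; have := mf i.+1; rewrite rmorphM /= (tay_layer_form j0 gj).
rewrite -mulrA coefXM coefCM /= => E.
apply/eqP; have /eqP := E (ltac:(lia)).
by rewrite mulf_eq0 (negbTE (layer_form_neq0 v j0)).
Qed.

Lemma mult_off_layer g j v m f : j != ord0 -> g j != v ->
  mult (grid_pt g) m (layer_form j v * f) -> mult (grid_pt g) m f.
Proof.
move=> j0 gj; apply: mult_cancel (layer_form_homog j v) _.
rewrite mevalB mevalZ !mevalXU /grid_pt (negbTE j0) eqxx mulr1 subr_eq0.
by apply: contraNneq gj => /(pchar0_natr_inj char0) ->.
Qed.

(* If [f] vanishes on the layers [x_j = v x_0] to the orders [w v], the heaviest layer
   is contained in the zero set of [f] and can be divided out. *)
Lemma grid_layers J (j : 'I_N.+1) : j = J.+1 :> nat ->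
    (forall m f, depends_on J f ->
       (forall g, (forall i, (g i < t)%N) -> (forall i : 'I_N.+1, (J < i)%N -> g i = 0%N) ->
         mult (grid_pt g) m f) ->
       (msize f <= t * m)%N -> f = 0) ->
  forall w f, depends_on J.+1 f ->
    (forall g, (forall i, (g i < t)%N) -> (forall i : 'I_N.+1, (J.+1 < i)%N -> g i = 0%N) ->
      mult (grid_pt g) (w (g j)) f) ->
    (msize f <= \sum_(v < t) w v)%N -> f = 0.
Proof.
move=> jJ IHJ w f; have [n] := ubnP (msize f); elim: n w f => // n IH w f ltn df mf lef.
have [//|nz] := eqVneq f 0.
have j0 : j != ord0 by apply/eqP => E; move: jJ; rewrite E.
have t_gt0 : (0 < t)%N.
  case: (posnP t) => // t0; move: lef; rewrite t0 big_ord0 leqn0 msize_poly_eq0.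
  by rewrite (negbTE nz).
have [v _ vmax] := @arg_maxnP _ (Ordinal t_gt0) xpredT (fun v : 'I_t => w v) isT.
have lesum : (\sum_(v < t) w v <= t * w v)%N.
  rewrite -[X in (X * _)%N]card_ord -sum_nat_const; apply: leq_sum => u _; exact: vmax.
have sub0 : msubst (layer j v) f = 0.
  apply: (IHJ (w v)).
  - rewrite /depends_on -{1}df -[in RHS]df.
    apply: (@mpoly_rmorph_ext _ _ _ (msubst (first_vars J) \o (msubst (layer j v) \o msubst (first_vars J.+1)))
      (msubst (layer j v) \o msubst (first_vars J.+1))) => [c|i] /=.
      by rewrite !msubstC.
    rewrite msubstX /first_vars; case: leqP => [lei|_]; last by rewrite !rmorph0.
    rewrite msubstX /layer; have [_|neq] := eqVneq i j.
      by rewrite -mul_mpolyC rmorphM /= msubstC msubstX.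
    by rewrite msubstX ifT //; move: neq; rewrite -val_eqE /= jJ; lia.
  - move=> g gt g0; pose g' i := if i == j then v : nat else g i.
    have g'j : g' j = v by rewrite /g' eqxx.
    have ml := @mult_layer g' j v (w v) f j0 g'j.
    have E : grid_pt g =1 grid_pt (fun i => if i == j then 0%N else g' i).
      move=> i; rewrite /grid_pt /g'; case: ifP => // _; case: eqP => // ->.
      by rewrite g0 // jJ.
    move=> i lti; rewrite (tay_eq _ E) ml //.
    have := mf g'; rewrite g'j; apply=> [l|l ltl]; rewrite /g'.
      by case: ifP => // _; exact: ltn_ord.
    case: eqP => [E'|_]; first by move: ltl; rewrite E' jJ ltnn.
    by apply: g0; exact: ltnW.
  apply: leq_trans (msize_msubst _ _) (leq_trans lef lesum) => i.
  rewrite /layer; case: ifP => _; last by rewrite msizeX mdeg1.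
  by rewrite (leq_trans (msizeZ_le _ _)) // msizeX mdeg1.
have [q0] := layer_division j v f; rewrite sub0 subr0 => fE.
(* The quotient may involve later variables; setting them to zero preserves the equation, as neither
   [f] nor the layer form contains them. *)
pose q := msubst (first_vars J.+1) q0.
have {}fE : f = layer_form j v * q.
  rewrite -df fE rmorphM /=; congr (_ * _).
  rewrite /layer_form rmorphB /= -mul_mpolyC rmorphM /= msubstC !msubstX /first_vars.
  by rewrite jJ leqnn.
have dq : depends_on J.+1 q.
  rewrite /depends_on /q.
  apply: (@mpoly_rmorph_ext _ _ _ (msubst (first_vars J.+1) \o msubst (first_vars J.+1))
      (msubst (first_vars J.+1))) => [c|i] /=; first by rewrite !msubstC.
  rewrite msubstX /first_vars; case: leqP => lei; last by rewrite rmorph0.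
  by rewrite msubstX lei.
have qnz : q != 0 by apply: contraNneq nz => q0'; rewrite fE q0' mulr0.
have szf : msize f = (msize q).+1 by rewrite fE msize_layer_form.
have wv : (0 < w v)%N.
  by move: (leq_trans lef lesum); rewrite szf; case: (w v) => //; rewrite muln0.
suff q0' : q = 0 by rewrite fE q0' mulr0.
apply: (IH (fun u => if u == v then (w u).-1 else w u)) => //.
- by move: ltn; rewrite szf.
- move=> g gt g0; have := mf g gt g0; rewrite {1}fE.
  case: eqP => [gv|/eqP gv]; first exact: mult_layer_factor.
  exact: mult_off_layer.
move: lef; rewrite szf (bigD1 v) //= [X in _ -> (_ <= X)%N](bigD1 v) //= eqxx.
have -> : (\sum_(i < t | i != v) (if i == v :> nat then (w i).-1 else w i) =
    \sum_(i < t | i != v) w i)%N.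
  by apply: eq_bigr => u; rewrite -val_eqE => /negbTE ->.
by case: (w v) wv => // e _; rewrite addSn ltnS.
Qed.

(** Induction on the number of variables, with equal weights on the layers. For [J = 0], [f]
    involves x_0 only and is its own Taylor expansion at (1 : 0 : ... : 0). *)
Lemma grid_vanish J : (J <= N)%N -> forall m f, depends_on J f ->
  (forall g, (forall i, (g i < t)%N) -> (forall i : 'I_N.+1, (J < i)%N -> g i = 0%N) ->
     mult (grid_pt g) m f) ->
  (msize f <= t * m)%N -> f = 0.
Proof.
elim: J => [|J IH] leJ m f df mf lef.
  case: m mf lef => [|m] mf; first by rewrite muln0 leqn0 msize_poly_eq0 => /eqP.
  case: (posnP t) => [->|t_gt0 _]; first by rewrite mul0n leqn0 msize_poly_eq0 => /eqP.
  have := mf (fun _ => 0%N) (fun _ => t_gt0) (fun _ _ => erefl) 0%N isT.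
  have -> : tay (grid_pt (fun _ => 0%N)) f = f%:P; last by rewrite coefC.
  rewrite -[in LHS]df -[in RHS]df.
  apply: (@mpoly_rmorph_ext _ _ _ (tay (grid_pt (fun _ => 0%N)) \o msubst (first_vars 0))
      (polyC \o msubst (first_vars 0))) => [c|i] /=.
    by rewrite msubstC tayE mmapC.
  rewrite msubstX /first_vars leqn0; case: eqP => [i0|_]; last by rewrite !rmorph0.
  by have -> : i = ord0 by [apply: val_inj]; rewrite tay_X0.
apply: (@grid_layers J (Ordinal (leJ : (J.+1 < N.+1)%N)) erefl (IH (ltnW leJ)) (fun _ => m)) => //.
by rewrite sum_nat_const card_ord.
Qed.

Lemma grid_no_form s : (0 < t)%N -> (t ^ N <= s)%N ->
  exists a : 'I_s -> 'I_N.+1 -> k, forall m, no_form a m (t * m).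
Proof.
move=> t_gt0 les.
have les' : (#|{: {ffun 'I_N -> 'I_t}}| <= s)%N by rewrite card_ffun !card_ord.
(* Indices past the size of the grid repeat its point (1 : 0 : ... : 0), which adds no condition. *)
pose gr (i : 'I_s) (j : 'I_N.+1) : nat :=
  if (insub (i : nat) : option 'I_#|{: {ffun 'I_N -> 'I_t}}|) is Some u then
    if unlift ord0 j is Some l then (enum_val u : {ffun 'I_N -> 'I_t}) l : nat else 0%N
  else 0%N.
exists (fun i => grid_pt (gr i)) => m f lef mf.
apply: (@grid_vanish N (leqnn _) m) => //.
  rewrite /depends_on; apply: (@mpoly_rmorph_ext _ _ _ (msubst (first_vars N)) idfun) => [c|i] /=.
    by rewrite msubstC.
  by rewrite msubstX /first_vars -ltnS ltn_ord.
move=> g gt _; pose e : {ffun 'I_N -> 'I_t} := [ffun l => Ordinal (gt (lift ord0 l))].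
pose i := widen_ord les' (enum_rank e).
have E : grid_pt g =1 grid_pt (gr i).
  move=> j; rewrite /grid_pt; case: eqP => // /eqP j0; congr (_%:R).
  rewrite /gr valK enum_rankK; case: unliftP => [l|] jE; last by rewrite jE eqxx in j0.
  by rewrite ffunE jE.
by move=> l ltl; rewrite (tay_eq _ E) mf.
Qed.

End Grid.

(** * Vertices of a simplex *)

Section Simplex.

Variables (k : fieldType) (N : nat).
Local Notation mpo := {mpoly k[N.+1]}.

Definition simplex_pt (i j : 'I_N.+1) : k := ((j == ord0) || (j == i))%:R.

(** Barycentric coordinates: the vertices, all with x_0 = 1, become the coordinate points. *)
Definition bary (i : 'I_N.+1) : mpo := if i == ord0 then \sum_j 'X_j else 'X_i.

Definition unbary (i : 'I_N.+1) : mpo :=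
  if i == ord0 then 'X_ord0 - \sum_(j | j != ord0) 'X_j else 'X_i.

Lemma msubst_baryK f : msubst unbary (msubst bary f) = f.
Proof.
apply: (@mpoly_rmorph_ext _ _ _ (msubst unbary \o msubst bary) idfun) => [c|i] /=.
  by rewrite !msubstC.
rewrite msubstX /bary; case: eqP => [->|/eqP neq]; last by rewrite msubstX /unbary (negbTE neq).
rewrite rmorph_sum (bigD1 ord0) //= msubstX /unbary eqxx.
have -> : \sum_(j < N.+1 | j != ord0) msubst unbary 'X_j = \sum_(j < N.+1 | j != ord0) 'X_j.
  by apply: eq_bigr => j neq; rewrite msubstX /unbary (negbTE neq).
by rewrite subrK.
Qed.

(** Order at the i-th coordinate point: the degree in the variables other than x_i is at least
    [e]. *)
Definition order_off (i : 'I_N.+1) (e : nat) (f : mpo) : Prop :=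
  forall mu, mu \in msupp f -> (e + mu i <= mdeg mu)%N.

Lemma order_off_filtration i : filtration (fun e f => order_off i e (msubst bary f)).
Proof.
split.
- by move=> f mu _; rewrite add0n mdegE (bigD1 i) //= leq_addr.
- by move=> e mu; rewrite rmorph0 msupp0.
- move=> e f g hf hg mu; rewrite rmorphD => /msuppD_le; rewrite mem_cat.
  by case/orP; [exact: hf | exact: hg].
- move=> d e f g hf hg mu; rewrite rmorphM => /msuppM_le /allpairsP[[m1 m2] /= [h1 h2 ->]].
  by rewrite mnmDE mdegD; have := hf _ h1; have := hg _ h2; lia.
- by move=> e f hf mu /hf; lia.
Qed.

Lemma order_off_lin i j : order_off i 1 (msubst bary (lin (simplex_pt i) j)).
Proof.
have subZ c x : msubst bary (c *: x) = c *: msubst bary x.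
  by rewrite -!mul_mpolyC rmorphM /= msubstC.
have hX l : l != i -> order_off i 1 'X_l.
  move=> neq mu; rewrite msuppX inE => /eqP ->; rewrite mdeg1 mnm1E.
  by rewrite (negbTE neq).
have h0 : order_off i 1 0 by move=> mu; rewrite msupp0.
rewrite linE rmorphB /= !subZ /simplex_pt eqxx /= scale1r !msubstX.
have [->|j0] := eqVneq j ord0; first by rewrite scale1r subrr.
have [->|ji] /= := eqVneq j i; last first.
  by rewrite scale0r subr0 /bary (negbTE j0); exact: hX.
rewrite scale1r; have [->|i0] := eqVneq i ord0; first by rewrite subrr => mu; rewrite msupp0.
rewrite /bary (negbTE i0) eqxx (bigD1 i) //= opprD addrA subrr sub0r => mu.
rewrite (perm_mem (msuppN _)) => /msupp_sum_le /flatten_mapP[l].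
by rewrite mem_filter => /andP[neq _]; exact: hX.
Qed.

(** A monomial of degree [D] has degree [D - mu_i >= N c] off each vertex; summing over the N + 1
    vertices gives [N D >= (N + 1) N c]. *)
Lemma simplex_no_form s c : (0 < N)%N -> (N < s)%N ->
  exists a : 'I_s -> 'I_N.+1 -> k, no_form a (N * c) (N.+1 * c).
Proof.
move=> N_gt0 lts; exists (fun i => simplex_pt (inord i)) => f lef mf.
suff f0 : msubst bary f = 0 by rewrite -(msubst_baryK f) f0 rmorph0.
apply/eqP; rewrite -msupp_eq0; case E : (msupp (msubst bary f)) => [//|mu r].
have hmu : mu \in msupp (msubst bary f) by rewrite E mem_head.
have hoff i : (N * c + mu i <= mdeg mu)%N.
  apply: (mult_in_filtration (order_off_filtration i) (a := simplex_pt i)) hmu.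
  - by move=> j; exact: order_off_lin.
  - by rewrite /simplex_pt eqxx oner_eq0.
  - by have := mf (widen_ord lts i); rewrite /= inord_val.
have : (\sum_(i < N.+1) (N * c + mu i) <= \sum_(i < N.+1) mdeg mu)%N.
  by apply: leq_sum => i _; exact: hoff.
rewrite big_split /= -mdegE !sum_nat_const card_ord.
have : (mdeg mu < N.+1 * c)%N.
  apply: leq_trans (msize_mdeg_lt hmu) (leq_trans (msize_msubst _ _) lef) => i.
  rewrite /bary; case: ifP => _; last by rewrite msizeX mdeg1.
  elim/big_ind: _ => [|x y lex ley|j _]; [by rewrite msize0 | | by rewrite msizeX mdeg1].
  by rewrite (leq_trans (mmeasureD_le _ _ _)) // geq_max lex.
rewrite -(ltn_pmul2l N_gt0) mulSn [(N.+1 * _)%N]mulSn; move: (mdeg mu) => D.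
by rewrite mulnDr; lia.
Qed.

End Simplex.

(** * Numerical estimates and conclusion *)

Lemma bin_add_ge n N q : ('C(n.+1, N.+1) + q * 'C(n, N) <= 'C(n.+1 + q, N.+1))%N.
Proof.
elim: q => [|q IH]; first by rewrite mul0n !addn0.
have le : ('C(n, N) <= 'C(n.+1 + q, N))%N by apply: leq_bin2l; lia.
by rewrite addnS [X in (_ <= X)%N]binS mulSn; lia.
Qed.

(** By [bin_add_ge] and the absorption identity this reduces to [n >= N]. *)
Lemma bin_grid_step N q : (1 < N)%N -> (0 < q)%N ->
  (q.+1 * 'C(N * q.+1 - 2, N) <= 'C(N.+1 * q.+1 - 2, N.+1))%N.
Proof.
move=> N_gt1 q_gt0; set n := (N * q.+1 - 2)%N.
have nE : (n + 2 = N * q.+1)%N by rewrite subnK //; nia.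
have -> : (N.+1 * q.+1 - 2 = n.+1 + q)%N by rewrite mulSn -nE; lia.
rewrite -(leq_pmul2l (ltn0Sn N)).
apply: leq_trans (leq_mul (leqnn N.+1) (bin_add_ge n N q)).
rewrite mulnDr -mul_bin_diag !mulnA -mulnDl; apply: leq_mul => //.
by nia.
Qed.

(** For [q = r %/ N], [N (q + 1) - 2] bounds [N + rho - 1] from below. Induction on [N] starts at 3
    if [q > 1]. For [q = 1] it starts at 5, since [N = 4] is the equality 16 = 15 + 1; [N = 3]
    fails, as 8 > 4 + 1. *)
Lemma grid_size N q : (2 < N)%N -> (0 < q)%N -> (N == 3) && (q == 1%N) = false ->
  (q.+1 ^ N <= ('C(N * q.+1 - 2, N)).+1)%N.
Proof.
move=> N_gt2 q_gt0 exc; have step n : (1 < n)%N -> (q.+1 ^ n <= 'C(n * q.+1 - 2, n))%N ->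
    (q.+1 ^ n.+1 <= 'C(n.+1 * q.+1 - 2, n.+1))%N.
  move=> n_gt1 IH; rewrite expnS; apply: leq_trans (bin_grid_step n_gt1 q_gt0).
  by rewrite leq_mul2l IH orbT.
have up n0 : (1 < n0)%N -> (q.+1 ^ n0 <= 'C(n0 * q.+1 - 2, n0))%N ->
    forall n, (n0 <= n)%N -> (q.+1 ^ n <= 'C(n * q.+1 - 2, n))%N.
  move=> gt1 base; elim=> [|n IH]; first by rewrite leqn0 => /eqP n0E; rewrite n0E in gt1.
  rewrite leq_eqVlt => /orP[/eqP <- //|len]; apply: step; last exact: IH.
  exact: leq_trans gt1 len.
have [q1|q_neq1] := eqVneq q 1%N.
  move: exc step up; rewrite q1 andbT => N3 step up.
  have [N4|N_neq4] := eqVneq N 4; first by rewrite N4.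
  by apply: leqW; apply: (up 5) => //; move: N3 N_neq4 N_gt2; lia.
apply: leqW; apply: (up 3) => //.
rewrite -(@leq_pmul2r (3`!)) // bin_ffact !ffactnS ffactn0.
have q_gt1 : (1 < q)%N by lia.
have -> : (3 * q.+1 - 2 = (3 * q).+1)%N by lia.
rewrite /= -[(3 * q).-1]subn1 !expnS expn0 -[3`!]/6%N; nia.
Qed.

Lemma bin_unbounded N s : (0 < N)%N -> (s <= 'C(N + s, N))%N.
Proof.
case: N => // N _; elim: s => // s IH; rewrite addnS binS.
rewrite -addn1; apply: leq_add => //.
by rewrite bin_gt0; lia.
Qed.

Lemma special_no_form (k : fieldType) (N s rho : nat) : [pchar k] =i pred0 ->
    (2 < N)%N -> (0 < s)%N -> (0 < rho -> 'C(N + rho.-1, N) < s)%N ->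
  exists m d, (rho.+1 * (m + N) < N * d)%N /\
    exists a : 'I_s -> 'I_N.+1 -> k, no_form a m d.
Proof.
move=> char0 N_gt2 s_gt0 minr; set r := rho.+1; set t := (r %/ N).+1.
have [small|large] := leqP (t ^ N) s.
  have [a aP] := grid_no_form char0 (ltn0Sn _) small.
  (* As [t N >= r + 1], [N d - r m >= m = r N + 1 > r N]. *)
  exists (r * N).+1, (t * (r * N).+1)%N; split; last by exists a.
  have : (r < t * N)%N by apply: ltn_ceil; lia.
  by nia.
have q_gt0 : (0 < r %/ N)%N.
  by case: posnP => // q0; move: large; rewrite /t q0 exp1n ltnNge s_gt0.
have leNr : (N * (r %/ N) <= r)%N by rewrite mulnC leq_trunc_div.
have rho_gt0 : (0 < rho)%N by move: leNr; rewrite /r; nia.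
have {}minr := minr rho_gt0.
have [/andP[/eqP N3 /eqP q1]|/negbTE exc] := boolP ((N == 3) && (r %/ N == 1)%N); last first.
  have := grid_size N_gt2 q_gt0 exc; rewrite -/t => le; exfalso.
  move: large; apply/negP; rewrite -leqNgt; apply: (leq_trans le); apply: leq_trans minr.
  by rewrite ltnS; apply: leq_bin2l; rewrite mulnS; move: leNr; rewrite /r; lia.
have [r3|r_neq3] := eqVneq r 3.
  (* 4 is the least [c] with [3 (3 c + 3) < 3 (4 c)]. *)
  have [|a aP] := @simplex_no_form k N s 4 (ltac:(lia)).
    by rewrite N3; move: minr; rewrite N3 (_ : rho = 2) //; [exact: ltnW | case: r3].
  by exists (N * 4)%N, (N.+1 * 4)%N; split; [rewrite r3 N3 | exists a].
exfalso; move: large; rewrite /t q1 N3; apply/negP; rewrite -leqNgt.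
(* Now [r >= 4], so [s] exceeds 'C(5, 3) = 10, while the grid has 8 points. *)
apply: leq_trans minr; rewrite N3; apply: (@leq_trans 'C(5, 3).+1) => //.
rewrite ltnS; apply: leq_bin2l; move: leNr r_neq3; rewrite q1 N3 /r; lia.
Qed.

Lemma symb_pow_mult (k : fieldType) (N s : nat) (a : 'I_s -> 'I_N.+1 -> k) m f :
  points_symb_pow a m f -> forall i, mult (a i) m f.
Proof.
move=> sf i; apply: ideal_pow_sub_filtration (sf i); first exact: mult_filtration.
have [_ M0 MD MM _] := mult_filtration (a i).
apply: ideal_gen_ind => // [x z|c x [d [hx x0]]]; first exact: MD.
by apply: (MM 0%N 1%N) => //; apply: mult1_homog hx _.
Qed.

(** If [e / b] exceeds the bound, a nonzero component of degree [t] and multiplicity [e] has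
    [e d <= t (m + N)], hence [t >= b r], and [homog_mult_in_pow] applies. *)
Lemma points_resurgence (k : fieldType) (N s rho m d : nat)
    (a : 'I_s -> 'I_N.+1 -> k) (F : 'I_s -> {mpoly k[N.+1]}) :
    [pchar k] =i pred0 -> (1 < N)%N -> (forall i, a i ord0 != 0) ->
    (forall i, F i \is rho.-homog) -> (forall i j, (F i).@[a j] = (i == j)%:R) ->
    no_form a m d -> (rho.+1 * (m + N) < N * d)%N ->
  resurgence_lt (points_ideal a) (points_symb_pow a) N%:R.
Proof.
move=> char0 N_gt1 a0 hF FE nof ltd.
have d_gt0 : (0 < d)%N by case: (d) ltd; rewrite ?muln0.
(* The 1 forces [b < e], so that multiplicity [e] implies multiplicity [b]. *)
exists (Num.max 1 ((rho.+1 * (m + N))%:R / d%:R)); split.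
  by rewrite gt_max ltr1n N_gt1 ltr_pdivrMr ?ltr0n // -natrM ltr_nat.
move=> e b e_gt0 b_gt0 nsub; rewrite leNgt; apply/negP.
rewrite gt_max => /andP[]; rewrite ltr_pdivlMr ?ltr0n // mul1r ltr_nat => lt_be.
rewrite ltr_pdivrMr ?ltr0n // mulrAC ltr_pdivlMr ?ltr0n // -!natrM ltr_nat => lt_e.
apply: nsub => f /symb_pow_mult mf.
rewrite (pihomog_partitionE (leqnn (mmeasure mdeg f))); apply: ideal_gen_sum => t _.
set g := pihomog mdeg t f; have hg : g \is t.-homog by exact: pihomogP.
have mg i : mult (a i) e g by exact: mult_pihomog.
have [->|nz] := eqVneq g 0; first exact: ideal_gen0.
have szg : (msize g <= t.+1)%N.
  by rewrite -(mlead_deg nz) ltnS; have /dhomogP /(_ _ (mlead_supp nz)) /= -> := hg.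
have le_t := pchar0_degree_bound char0 a0 nof nz szg mg.
apply: (homog_mult_in_pow a0 hF FE _ hg) => [|i].
  have mN_gt0 : (0 < m + N)%N by lia.
  by rewrite -(leq_pmul2r mN_gt0); apply: leq_trans le_t; nia.
by apply: (filtration_le (mult_filtration (a i)) _ (mg i)); exact: ltnW.
Qed.

Theorem theorem4p2 (k : fieldType) (N s : nat) :
  [pchar k] =i pred0 -> (3 <= N)%N -> (1 <= s)%N ->
  general_points (fun a : 'I_s -> 'I_N.+1 -> k =>
    resurgence_lt (points_ideal a) (points_symb_pow a) N%:R).
Proof.
move=> char0 N_ge3 s_ge1.
have exr : exists rho, (s <= 'C(N + rho, N))%N by exists s; apply: bin_unbounded; lia.
have [rho les minr] := ex_minnP exr.
have lts : (0 < rho -> 'C(N + rho.-1, N) < s)%N.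
  by move=> rho_gt0; rewrite ltnNge; apply/negP => /minr; lia.
have [m [d [ltd nof]]] := special_no_form char0 N_ge3 s_ge1 lts.
have [p [[v pv] pP]] := gen_openI char0 (gen_open_nonzero0 k N s)
  (gen_openI char0 (gen_open_separators char0 les) (gen_open_no_form nof)).
exists (fun v => p.@[v] != 0); split.
  exists (eq p) => w; split=> [/eqP nz h|h]; first by apply: nz; exact: h.
  by apply/negP => /eqP pw; apply: h => q <-; exact: pw.
split; first by exists v.
move=> A /pP.
have -> : coord_points (param_coords A) = (fun i j => A i j).
  apply: functional_extensionality => i; apply: functional_extensionality => j.
  by rewrite /coord_points /param_coords mxvecE.
move=> [a0 [[F [hF FE]] noA]]; split; last first.
  exact: points_resurgence char0 (ltnW N_ge3) a0 hF FE noA ltd.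
(* Proportional points could not be told apart by [F i]. *)
split=> [i|i i' neq [t tE]]; first by exists ord0.
have := FE i i; rewrite eqxx (meval_homogZ (hF i) tE) FE (negbTE neq) mulr0.
by move/eqP; rewrite eq_sym oner_eq0.
Qed.
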